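(* Let $\mathbb{P}$ be a distribution on $\mathbb{R}^p$ generated by a PLSEM whose DAG $D^0$ is such that $\mathbb{P}$ is faithful to $D^0$ (so $\mathscr{D}(\mathbb{P})\neq\emptyset$). Then $\mathscr{D}(\mathbb{P})$ equals the set of all consistent DAG extensions of the PDAG $G_{\mathscr{D}(\mathbb{P})}$.
   Context: A DAG $D$ on $\{1,\dots,p\}$ has parent sets $\mathrm{pa}_D(j)$. A PLSEM (partially linear additive structural equation model with Gaussian noise) with DAG $D$ is a system $X_j=\mu_j+\sum_{i\in\mathrm{pa}_D(j)} f_{j,i}(X_i)+\varepsilon_j$, $j=1,\dots,p$, where $\mu_j\in\mathbb{R}$, $f_{j,i}\in C^2(\mathbb{R})$, $f_{j,i}\not\equiv 0$, $\mathbb{E}[f_{j,i}(X_i)]=0$, and $\varepsilon_1,\dots,\varepsilon_p$ are mutually independent with $\varepsilon_j\sim\mathcal{N}(0,\sigma_j^2)$, $\sigma_j^2>0$; the distribution of the (unique) solution $X$ is said to be generated by the PLSEM. $\mathbb{P}$ is faithful to a DAG $D$ if the conditional independences holding in $\mathbb{P}$ are exactly those implied by d-separation in $D$. The distribution equivalence class is $\mathscr{D}(\mathbb{P})=\{D:\ \mathbb{P}\text{ is faithful to }D\text{ and some PLSEM with DAG }D\text{ generates }\mathbb{P}\}$; all its members are Markov equivalent (same skeleton and v-structures). A PDAG is a graph with directed and undirected edges and no directed cycle. $G_{\mathscr{D}(\mathbb{P})}$ is the PDAG with the common skeleton of the DAGs in $\mathscr{D}(\mathbb{P})$, in which $i\to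 j$ is directed iff $i\to j$ in every DAG of $\mathscr{D}(\mathbb{P})$, and otherwise the edge is undirected. A consistent DAG extension of a PDAG $G$ is a DAG with the same skeleton as $G$, the same orientation of every directed edge of $G$, and no v-structures other than those of $G$. *)

(* Defs.v *)
From HB Require Import structures.
From mathcomp Require Import all_boot all_order all_algebra.
From mathcomp Require Import all_classical all_reals all_analysis.
Set Implicit Arguments. Unset Strict Implicit. Unset Printing Implicit Defensive.
Import Order.TTheory GRing.Theory Num.Theory numFieldNormedType.Exports.
Local Open Scope classical_set_scope.
Local Open Scope ring_scope.

(* A directed graph is a relation D : rel 'I_p, with D i j meaning i -> j. *)

Definition is_dag (p : nat) (D : rel 'I_p) : Prop :=
  forall i j, D i j -> ~~ connect D j i.

Definition skel (p : nat) (D : rel 'I_p) : rel 'I_p := fun u v => D u v || D v u.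

Definition dag_vstruct (p : nat) (D : rel 'I_p) (i k j : 'I_p) : Prop :=
  [/\ D i k, D j k, i != j & ~~ skel D i j].

Definition blocked_at (p : nat) (D : rel 'I_p) (C : {set 'I_p})
    (x : 'I_p) (s : seq 'I_p) (k : nat) : bool :=
  let t := x :: s in
  let u := nth x t k.-1 in let v := nth x t k in let w := nth x t k.+1 in
  let collider := D u v && D w v in
  (~~ collider && (v \in C)) ||
  (collider && ~~ [exists z, connect D v z && (z \in C)]).

Definition dsep (p : nat) (D : rel 'I_p) (A B C : {set 'I_p}) : Prop :=
  forall (a b : 'I_p) (s : seq 'I_p),
    a \in A -> b \in B -> path (skel D) a s -> uniq (a :: s) -> last a s = b ->
    exists2 k, (0 < k < size s)%N & blocked_at D C a s k.

Section CI.
Context {R : realType} {p : nat}.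
Local Notation V := (p.-tuple R).

Definition depends_only_on (S : {set 'I_p}) (Y : Type) (f : V -> Y) : Prop :=
  forall x y : V, (forall i, i \in S -> tnth x i = tnth y i) -> f x = f y.

(* events in sigma(X_S) *)
Definition S_event (S : {set 'I_p}) (E : set V) : Prop :=
  measurable E /\ depends_only_on S E.

Definition cond_prob_version (P : probability V R) (C : {set 'I_p})
    (E : set V) (h : V -> R) : Prop :=
  [/\ measurable_fun setT h, depends_only_on C h,
      (forall x, 0 <= h x <= 1) &
      forall F, S_event C F -> P (E `&` F) = (\int[P]_(x in F) (h x)%:E)%E].

Definition cond_indep (P : probability V R) (A B C : {set 'I_p}) : Prop :=
  forall EA EB, S_event A EA -> S_event B EB ->
    exists hA hB hAB,
      [/\ cond_prob_version P C EA hA, cond_prob_version P C EB hB,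
          cond_prob_version P C (EA `&` EB) hAB &
          {ae P, forall x, hAB x = hA x * hB x}].

Definition faithful (P : probability V R) (D : rel 'I_p) : Prop :=
  forall A B C : {set 'I_p},
    disjoint (mem A) (mem B) -> disjoint (mem A) (mem C) -> disjoint (mem B) (mem C) ->
    (cond_indep P A B C <-> dsep D A B C).

Definition C2 (f : R -> R) : Prop :=
  [/\ forall x, derivable f x 1, forall x, derivable (derive1 f) x 1 &
      continuous (fun x : R => derive1 (derive1 f) x)].

Definition generated_by_PLSEM (P : probability V R) (D : rel 'I_p) : Prop :=
  exists (mu : 'I_p -> R) (f : 'I_p -> 'I_p -> R -> R) (sigma : 'I_p -> R)
         (dO : measure_display) (O : measurableType dO) (Q : probability O R)
         (eps : 'I_p -> O -> R) (X : O -> V),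
    [/\ forall j, 0 < sigma j,
        forall j, measurable_fun setT (eps j),
        (forall B : 'I_p -> set R, (forall j, measurable (B j)) ->
           Q (\bigcap_(j in [set: 'I_p]) (eps j @^-1` B j)) =
           (\prod_(j < p) fine (Q (eps (j : 'I_p) @^-1` B j)))%:E),
        (forall j B, measurable B -> Q (eps j @^-1` B) = normal_prob 0 (sigma j) B) &
        [/\ forall i j, D i j ->
              [/\ C2 (f j i), exists x, f j i x != 0,
                  Q.-integrable setT (fun w => (f j i (tnth (X w) i))%:E) &
                  (\int[Q]_w (f j i (tnth (X w) i))%:E = 0)%E],
            forall w j, tnth (X w) j =
              mu j + \sum_(i | D i j) f j i (tnth (X w) i) + eps j w,
            measurable_fun setT X &
            forall E, measurable E -> P E = Q (X @^-1` E)]].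

Definition distr_equiv_class (P : probability V R) : rel 'I_p -> Prop :=
  fun D => [/\ is_dag D, faithful P D & generated_by_PLSEM P D].

End CI.

Record pdag (p : nat) := PDag {
  pdir : 'I_p -> 'I_p -> Prop;
  pund : 'I_p -> 'I_p -> Prop }.

Definition pdag_adj (p : nat) (G : pdag p) (i j : 'I_p) : Prop :=
  pdir G i j \/ pdir G j i \/ pund G i j \/ pund G j i.

Definition pdag_vstruct (p : nat) (G : pdag p) (i k j : 'I_p) : Prop :=
  [/\ pdir G i k, pdir G j k, i != j & ~ pdag_adj G i j].

(* G_S for a (nonempty, Markov equivalent) family S of DAGs: common skeleton,
   i -> j directed iff i -> j in every member of S, otherwise undirected. *)
Definition pdag_of_class (p : nat) (S : rel 'I_p -> Prop) : pdag p :=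
  let adj i j := exists D, S D /\ skel D i j in
  let dir i j := adj i j /\ (forall D, S D -> D i j) in
  PDag (fun i j => dir i j) (fun i j => adj i j /\ ~ dir i j /\ ~ dir j i).

Definition consistent_extension (p : nat) (G : pdag p) (D : rel 'I_p) : Prop :=
  [/\ is_dag D,
      (forall i j, skel D i j <-> pdag_adj G i j),
      (forall i j, pdir G i j -> D i j) &
      (forall i k j, dag_vstruct D i k j -> pdag_vstruct G i k j)].

(* Main.v *)
Require Import Defs.
From HB Require Import structures.
From mathcomp Require Import all_boot all_order all_algebra.
From mathcomp Require Import all_classical all_reals all_analysis.
From mathcomp Require Import measurable_realfun.
From mathcomp Require Import ring lra zify.
Set Implicit Arguments. Unset Strict Implicit. Unset Printing Implicit Defensive.
Import Order.TTheory GRing.Theory Num.Theory numFieldNormedType.Exports.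

(** The members of the class are faithful to the same law, hence have the same
d-separations, skeleton and v-structures; so every member is a consistent
extension.  Conversely, move from a member D1 to a consistent extension D by
Chickering's covered edge reversals: as long as D1 differs from D there is a
covered edge x -> y of D1 with y -> x in D.  This edge is undirected in the PDAG,
so some member D2 contains y -> x.

A law generated by a PLSEM has the density exp (- |F|^2 / 2) up to a constant,
F being the vector of standardised residuals, so D1 and D2 give |F1|^2 = |F2|^2 + k
pointwise.  Minimise both sides over the coordinates in reverse topological order
of D2.  On the right this drops one square; on the left a constant second
difference in the eliminated coordinate forces it to enter affinely, and the
minimum is the square of an orthogonal projection of F1.  When x is reached, y has
not been eliminated, and the edge function of x -> y turns out to be affine.

An affine covered edge can be reversed by completing the square in the density.
The new edge functions do not vanish, because a vanishing edge would be a
conditional independence (local Markov property) excluded by faithfulness. *)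

(** * d-separation and Markov equivalence *)

Section Separation.
Context {p : nat}.
Implicit Types (D : rel 'I_p) (C : {set 'I_p}) (a b u v w x y z : 'I_p).

(** The extension [D] is not known to generate the law, so it cannot itself be compared with [D1]:
    it only selects the edge to reverse, and the comparison uses a member [D2] that may change with
    every reversal. Equal square norms do not identify the residuals of [D1] and [D2] componentwise
    either, since reversing a linear edge already rotates them. What is followed through the
    elimination is therefore only what survives an orthogonal projection: additivity over the
    coordinates, a nondegeneracy condition expressed by orthogonality, and the pairings with vectors
    orthogonal to the eliminated directions. These pairings carry the affineness found after
    projection back to the original edge function. Densities are treated as iterated integrals, so
    that a unit triangular change of variables reduces to translation invariance in one coordinate
    and no Jacobian appears. *)

Lemma dag_asym D u v : is_dag D -> D u v -> D v u = false.
Proof.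
move=> dD Duv; apply/negbTE/negP => Dvu.
by have := dD _ _ Duv; rewrite (connect1 Dvu).
Qed.

Lemma dag_irr D u : is_dag D -> D u u = false.
Proof. by move=> dD; apply/negP => Duu; have := dD _ _ Duu; rewrite connect0. Qed.

(** The number of ancestors serves as a topological order; being at most [p], it also bounds the
    inductions along the order. *)
Definition dag_rank D (j : 'I_p) : nat := #|[set i | connect D i j]|.

Lemma dag_rank_lt D i j : is_dag D -> D i j -> (dag_rank D i < dag_rank D j)%N.
Proof.
move=> dD Dij; apply: proper_card; apply/properP; split.
  by apply/fintype.subsetP => k; rewrite !inE => /connect_trans; apply; exact: connect1.
by exists j; rewrite !inE ?connect0// (dD _ _ Dij).
Qed.

Definition has_desc D C v := [exists z, connect D v z && (z \in C)].

Lemma has_descW D C u v : connect D u v -> has_desc D C v -> has_desc D C u.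
Proof.
move=> uv /existsP[z /andP[vz zC]]; apply/existsP; exists z.
by rewrite zC (connect_trans uv vz).
Qed.

Definition pass D C v (collider : bool) :=
  if collider then has_desc D C v else v \notin C.

Definition open_at D C u v w := pass D C v (D u v && D w v).

Lemma blocked_atE D C a s k : blocked_at D C a s k =
  ~~ open_at D C (nth a (a :: s) k.-1) (nth a (a :: s) k) (nth a (a :: s) k.+1).
Proof. by rewrite /blocked_at /open_at /pass; case: ifP => //= _; rewrite negbK orbF. Qed.

Definition open_walk D C n (t : nat -> 'I_p) :=
  (forall k, (k < n)%N -> skel D (t k) (t k.+1)) /\
  (forall k, (0 < k < n)%N -> open_at D C (t k.-1) (t k) (t k.+1)).

(* Bayes-ball states: the flag records whether the last edge points into the
   current vertex. *)
Inductive trail D C a : 'I_p -> bool -> Prop :=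
| trail_start : trail D C a a false
| trail_fwd u d v : trail D C a u d -> u \notin C -> D u v -> trail D C a v true
| trail_bwd u d v : trail D C a u d -> pass D C u d ->
    D v u -> trail D C a v false.

Lemma skelC D u v : skel D u v = skel D v u. Proof. by rewrite /skel orbC. Qed.

Lemma open_walk_trail D C n t : is_dag D -> t 0 \notin C -> open_walk D C n t ->
  trail D C (t 0) (t n) ((0 < n)%N && D (t n.-1) (t n)).
Proof.
move=> dD t0C [sk op].
have {}op k : (0 < k < n)%N -> open_at D C (t k.-1) (t k) (t k.+1) by exact: op.
suff H m : (m <= n)%N -> trail D C (t 0) (t m) ((0 < m)%N && D (t m.-1) (t m)) by exact: H.
elim: m => [_|m IH mn]; first exact: trail_start.
have {}IH := IH (ltnW mn); move: (sk m mn); rewrite /skel /=.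
have [Dm _|_ /= Dm] := boolP (D (t m) (t m.+1)).
  apply: (trail_fwd IH) => //; case: m mn Dm {IH} => // m mn Dm.
  by have := op m.+1 mn; rewrite /open_at /pass (dag_asym dD Dm) andbF.
apply: (trail_bwd IH) => //; case: m mn Dm {IH} => //= m mn Dm.
by have := op m.+1 mn; rewrite /open_at /pass Dm andbT.
Qed.

Lemma trail_open_walk D C a v d : is_dag D -> trail D C a v d ->
  exists n t, [/\ t 0 = a, t n = v, open_walk D C n t &
                  d = (0 < n)%N && D (t n.-1) (t n)].
Proof.
move=> dD.
have ext u d' w : (exists n t, [/\ t 0 = a, t n = u, open_walk D C n t &
     d' = (0 < n)%N && D (t n.-1) (t n)]) -> skel D u w ->
     pass D C u (d' && D w u) ->
     exists n t, [/\ t 0 = a, t n = w, open_walk D C n t &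
                  D u w = (0 < n)%N && D (t n.-1) (t n)].
  move=> [n [t [t0 tn [sk op] ->]]] suw ok.
  exists n.+1, (fun k => if (k <= n)%N then t k else w); split => //=.
  - by rewrite ltnn.
  - split=> k.
      rewrite ltnS => kn; rewrite kn; case: (ltnP k n) => [/sk //|nk].
      by have -> : k = n; [apply/eqP; rewrite eqn_leq kn nk|rewrite tn].
    case/andP => k0; rewrite ltnS => kn; rewrite kn (leq_trans (leq_pred _) kn).
    case: (ltnP k n) => [kn'|nk]; first by apply: op; rewrite k0.
    have -> : k = n by apply/eqP; rewrite eqn_leq kn nk.
    by rewrite /open_at; move: ok; rewrite (leq_trans k0 kn) tn.
  by rewrite leqnn ltnn tn.
elim=> [|u d' w _ IH uC Duw|u d' w _ IH ok Dwu].
- by exists 0%N, (fun=> a); split => //; split => // k; case: k.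
- rewrite -Duw; apply: ext IH _ _; rewrite ?/skel ?Duw//.
  by rewrite (dag_asym dD Duw) andbF.
- rewrite -(dag_asym dD Dwu); apply: ext IH _ _; first by rewrite /skel Dwu orbT.
  by rewrite Dwu andbT.
Qed.

(* Following the walk forward from a tail, either a collider is met, or the walk
   stays directed and cannot come back. *)
Lemma open_walk_loop D C n t i j : is_dag D -> open_walk D C n t ->
  (0 < i)%N -> (i < j)%N -> (j < n)%N -> t i = t j ->
  open_at D C (t i.-1) (t i) (t j.+1).
Proof.
move=> dD [sk op] i0 ij jn tij.
have opi := op i; have opj := op j.
rewrite i0 (ltn_trans ij jn) in opi; rewrite (ltn_trans i0 ij) jn in opj.
have {}opi := opi isT; have {}opj := opj isT.
rewrite /open_at /pass; case: ifP => [/andP[Du Dw]|]; last first.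
  move=> /negbT; rewrite negb_and => /orP[/negbTE nu|/negbTE nw].
    by move: opi; rewrite /open_at /pass nu.
  by move: opj; rewrite /open_at /pass -tij nw andbF.
have [Di|nDi] := boolP (D (t i) (t i.+1)); last first.
  have := sk i (ltn_trans ij jn); rewrite /skel (negbTE nDi) /= => Di'.
  by move: opi; rewrite /open_at /pass Du Di'.
suff H m : (i + m < j)%N -> has_desc D C (t i) \/
    (connect D (t i) (t (i + m)) /\ D (t (i + m)) (t (i + m).+1)).
  have ej : (i + (j - i.+1)).+1 = j by lia.
  have /H[|[c]] : (i + (j - i.+1) < j)%N by lia.
    by [].
  by rewrite ej -tij => /dD; rewrite c.
elim: m => [|m IH] im; first by right; rewrite addn0 connect0.
have lt0 : (i + m < j)%N by lia.
have [h|[c d]] := IH lt0; first by left.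
have c' : connect D (t i) (t (i + m.+1)).
  by rewrite addnS; apply: connect_trans c (connect1 d).
have [d'|nd'] := boolP (D (t (i + m.+1)) (t (i + m.+1).+1)); first by right.
left; have lt1 : (i + m.+1 < n)%N by lia.
have := sk _ lt1; rewrite /skel (negbTE nd') /= => d'.
have := op (i + m.+1)%N; rewrite lt1 addnS /= => /(_ isT).
by rewrite /open_at /pass d /= -addnS d' => /(has_descW c').
Qed.

Lemma open_walk_cut D C n t i j : is_dag D -> open_walk D C n t ->
  (i < j)%N -> (j <= n)%N -> t i = t j ->
  exists2 t', open_walk D C (n - (j - i)) t' & (t' 0 = t 0 /\ t' (n - (j - i))%N = t n).
Proof.
move=> dD wt ij jn tij; have [sk op] := wt.
pose t' k := if (k <= i)%N then t k else t (k + (j - i))%N.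
have t'E k : (i <= k)%N -> t' k = t (k + (j - i))%N.
  rewrite /t'; case: ltngtP => // <- _; rewrite tij; congr t; lia.
have t'l k : (k <= i)%N -> t' k = t k by rewrite /t' => ->.
exists t'; last by split; [rewrite t'l|rewrite t'E; [congr t|]; lia].
split=> k.
  move=> kn; case: (ltnP k i) => ki; first by rewrite !t'l //; [apply: sk|]; lia.
  by rewrite !t'E //; [apply: sk|]; lia.
move=> /andP[k0 kn]; case: (ltngtP k i) => ki.
- by rewrite !t'l; [apply: op|..]; lia.
- rewrite !t'E; [|lia..].
  have -> : (k.-1 + (j - i) = (k + (j - i)).-1)%N by lia.
  by rewrite addSn; apply: op; lia.
- rewrite ki t'l; last by lia.
  rewrite t'l// t'E; last by lia.
  have -> : (i.+1 + (j - i) = j.+1)%N by lia.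
  by apply: open_walk_loop dD wt _ _ _ tij; lia.
Qed.

(** Trails may revisit vertices while [dsep] ranges over simple paths; cutting loops without losing
    openness bridges the two. *)
Lemma open_walk_inj D C n t : is_dag D -> open_walk D C n t ->
  exists m t', [/\ open_walk D C m t', t' 0 = t 0, t' m = t n &
    {in [pred k | k <= m] &, injective t'}]%N.
Proof.
move=> dD; elim: n {-2}n (leqnn n) t => [|N IH] n nN t wt.
  exists n, t; split => // i j; rewrite !inE; lia.
have [inj|] := pselect {in [pred k | k <= n]%N &, injective t}; first by exists n, t.
move=> ninj.
have [i [j [ij jn tij]]] : exists i j, [/\ (i < j)%N, (j <= n)%N & t i = t j].
  apply: contra_notP ninj => H i j; rewrite !inE => ik jk tij.
  case: (ltngtP i j) => // l; exfalso; apply: H; first by exists i, j.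
  by exists j, i.
have [t' wt' [t'0 t'n]] := open_walk_cut dD wt ij jn tij.
have [|m [t2 [wm e0 em inj]]] := IH _ _ t' wt'; first by lia.
by exists m, t2; split; rewrite ?e0 ?em.
Qed.

Lemma dsep_trailP D (A B C : {set 'I_p}) : is_dag D ->
  disjoint (mem A) (mem C) ->
  dsep D A B C <-> (forall a b d, a \in A -> b \in B -> ~ trail D C a b d).
Proof.
move=> dD /disjointFr dAC; split=> [ds a b d aA bB tr|ntr a b s aA bB pas us ls].
  have [n [t [t0 tn wt _]]] := trail_open_walk dD tr.
  have [m [t' [[sk op] e0 em inj]]] := open_walk_inj dD wt.
  pose s := mkseq (fun k => t' k.+1) m.
  have ss : size s = m by rewrite size_mkseq.
  have nths k : (k <= m)%N -> nth a (a :: s) k = t' k.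
    by case: k => [|k km] /=; rewrite ?e0 ?t0// nth_mkseq.
  have es : a :: s = mkseq t' m.+1.
    rewrite /s /mkseq /=; congr cons; first by rewrite e0 t0.
    by rewrite -[1%N]addn0 iotaDl -map_comp.
  have [|||k kk] := ds a b s aA bB.
  - apply/(pathP a) => k; rewrite ss => km.
    by rewrite nths ?(ltnW km)// nth_mkseq//; exact: sk.
  - rewrite es map_inj_in_uniq ?iota_uniq// => i j.
    by rewrite !mem_iota !add0n /= !ltnS; exact: inj.
  - by rewrite (last_nth a) ss nths// em tn.
  - rewrite blocked_atE; move: kk; rewrite ss => /andP[k0 km].
    rewrite !nths; [by rewrite op// k0|lia..].
have [[k]|nb] := pselect (exists2 k, (0 < k < size s)%N & blocked_at D C a s k).
  by exists k.
exfalso; have aC : a \notin C by rewrite (dAC a aA).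
pose t k := nth a (a :: s) k.
have : open_walk D C (size s) t.
  split=> k kn; first by move/(pathP a): pas => /(_ k kn).
  by apply: contra_notT nb => nop; exists k => //; rewrite blocked_atE.
move=> /(open_walk_trail dD aC); rewrite -last_nth ls.
exact: ntr.
Qed.

(** A trail that leaves [j] backwards stops at a parent, which is conditioned on. One that leaves
    forwards stays below [j]: turning at a collider there needs a descendant among the parents of
    [j], hence a cycle. The rank hypothesis keeps [i] out of the descendants of [j]. *)
Lemma nonadjacent_dsep D i j : is_dag D -> i != j -> ~~ skel D i j ->
  (dag_rank D i <= dag_rank D j)%N ->
  dsep D [set j] [set i] [set u | D u j].
Proof.
move=> dD nij nadj rij; set C := [set u | D u j].
have jC : j \notin C by rewrite inE dag_irr.
apply/(dsep_trailP _ dD) => [|a b d /set1P -> /set1P -> {a b} tr].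
  by rewrite disjoints1.
have inv v e : trail D C j v e ->
    if e then exists2 w, D j w & connect D w v else (v == j) || D v j.
  elim=> {v e} [|u e v _ IH uC Duv|u e v _ IH pu Dvu]; first by rewrite eqxx.
    case: e IH => [[w jw wu]|/orP[/eqP uj|Duj]].
    - by exists w => //; apply: connect_trans wu (connect1 Duv).
    - by exists v; rewrite ?connect0// -uj.
    - by rewrite inE Duj in uC.
  case: e IH pu => [[w jw wu] /existsP[z /andP[uz]]|/orP[/eqP <-|Duj]].
  - rewrite inE => Dzj; have := dD _ _ jw.
    by rewrite (connect_trans wu (connect_trans uz (connect1 Dzj))).
  - by rewrite Dvu orbT.
  - by rewrite /pass inE Duj.
move: tr => /inv; case: d => [[w jw wi]|/orP[/eqP ij|Dij]].
- have : (dag_rank D j < dag_rank D i)%N.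
    apply: leq_trans (dag_rank_lt dD jw) _; apply: subset_leq_card.
    by apply/fintype.subsetP => k; rewrite !inE => /connect_trans; apply.
  by rewrite ltnNge rij.
- by rewrite ij eqxx in nij.
- by rewrite /skel Dij in nadj.
Qed.

Definition dsep_le D1 D2 := forall A B C : {set 'I_p},
  disjoint (mem A) (mem B) -> disjoint (mem A) (mem C) -> disjoint (mem B) (mem C) ->
  dsep D1 A B C -> dsep D2 A B C.

Lemma adjacent_not_dsep D i j (C : {set 'I_p}) : i != j -> skel D i j ->
  ~ dsep D [set i] [set j] C.
Proof.
move=> nij sij ds; have [|||k] := ds i j [:: j] (set11 _) (set11 _) => //=.
- by rewrite sij.
- by rewrite inE nij.
- by case: k => [|[]].
Qed.

Lemma dsep_le_skel D1 D2 i j : is_dag D1 -> is_dag D2 -> dsep_le D1 D2 ->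
  skel D2 i j -> skel D1 i j.
Proof.
move=> d1 d2 le; wlog rij : i j / (dag_rank D1 i <= dag_rank D1 j)%N => [H|] s2.
  case: (leqP (dag_rank D1 i) (dag_rank D1 j)) => h; first exact: H.
  by rewrite skelC; apply: H; [exact: ltnW|rewrite skelC].
have nij : i != j.
  by apply: contraTneq s2 => ->; rewrite /skel dag_irr.
apply: contraT => nadj; have := nonadjacent_dsep d1 nij nadj rij.
move/le => /(_ _ _ _)/(adjacent_not_dsep _); rewrite eq_sym nij skelC s2.
case=> //; rewrite disjoints1 !inE ?(eq_sym j) ?dag_irr//.
by apply: contra nadj => D1ij; rewrite /skel D1ij.
Qed.

(** The parents of [j] in [D1] separate [i] from [j] and do not contain [k]. In [D2] the same set
    must block the path through [k], which is possible only if [k] is a collider there. *)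
Lemma dsep_le_vstruct D1 D2 i k j : is_dag D1 -> is_dag D2 ->
  dsep_le D1 D2 -> dsep_le D2 D1 ->
  dag_vstruct D1 i k j -> dag_vstruct D2 i k j.
Proof.
move=> d1 d2 le12 le21; wlog rij : i j / (dag_rank D1 i <= dag_rank D1 j)%N => [H|].
  case: (leqP (dag_rank D1 i) (dag_rank D1 j)) => h; first exact: H.
  move=> [ik jk nij nadj]; have [||? ? _ _] := H j i.
  - exact: ltnW.
  - by split; rewrite 1?eq_sym 1?skelC.
  split => //; apply: contra nadj; exact: (dsep_le_skel d1 d2 le12).
case=> ik jk nij nadj.
have n2 : ~~ skel D2 i j by apply: contra nadj; exact: (dsep_le_skel d1 d2 le12).
have s2ik : skel D2 i k by apply: (dsep_le_skel d2 d1 le21); rewrite /skel ik.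
have s2jk : skel D2 j k by apply: (dsep_le_skel d2 d1 le21); rewrite /skel jk.
have ki : k != i by apply: contraTneq ik => ->; rewrite dag_irr.
have kj : k != j by apply: contraTneq jk => ->; rewrite dag_irr.
have ds1 := nonadjacent_dsep d1 nij nadj rij.
have ds2 : dsep D2 [set j] [set i] [set u | D1 u j].
  apply: le12 ds1; rewrite disjoints1 !inE ?(eq_sym j) ?dag_irr//.
  by apply: contra nadj => D1ij; rewrite /skel D1ij.
have [|||m] := ds2 j i [:: k; i] (set11 _) (set11 _) => //=.
- by rewrite s2jk skelC s2ik.
- by rewrite !inE negb_or eq_sym kj eq_sym nij ki.
case: m => [|[|[]]]//= _; rewrite blocked_atE /open_at /pass /=.
case: ifP => [/andP[]|_]; first by [].
by rewrite inE negbK => /(dag_asym d1); rewrite jk.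
Qed.

Lemma connect_last (T : finType) (e : rel T) (a b : T) : connect e a b ->
  a = b \/ exists2 w, connect e a w & e w b.
Proof.
case/connectP => s; elim/last_ind: s => [|s w _] /=; first by left.
rewrite rcons_path last_rcons => /andP[ps ew] ->; right.
by exists (last a s) => //; apply/connectP; exists s.
Qed.

Lemma connect_indl (T : finType) (e : rel T) (b : T) (P : T -> Prop) : P b ->
  (forall a c : T, e a c -> connect e c b -> P c -> P a) -> forall a : T, connect e a b -> P a.
Proof.
move=> Pb Pe a /connectP[s]; elim: s a => [a _ /= <- //|c s IH a /= /andP[ac ps] ls].
by apply: Pe ac _ (IH _ ps ls); apply/connectP; exists s.
Qed.

Lemma connect_indr (T : finType) (e : rel T) (a : T) (P : T -> Prop) : P a ->
  (forall b c : T, connect e a b -> e b c -> P b -> P c) -> forall b : T, connect e a b -> P b.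
Proof.
move=> Pa Pe b /connectP[s]; elim/last_ind: s b => [b _ /= -> //|s c IH b].
rewrite rcons_path last_rcons => /andP[ps es] ->.
by apply: Pe es _; [apply/connectP; exists s|exact: IH].
Qed.

Definition covered D x y := D x y /\ forall z, D z y = D z x || (z == x).

Definition reverse_edge D x y : rel 'I_p := fun u v =>
  (D u v && ~~ ((u == x) && (v == y))) || ((u == y) && (v == x)).

(** * Reversing a covered edge preserves acyclicity and d-separation *)

Section CoveredReversal.
Variables (D : rel 'I_p) (x y : 'I_p).
Hypotheses (dD : is_dag D) (cov : covered D x y).
Let D' := reverse_edge D x y.
Let Dxy : D x y. Proof. by case: cov. Qed.
Let pay z : D z y = D z x || (z == x). Proof. by case: cov => _ ->. Qed.
Let nxy : (x == y) = false. Proof. by apply: contraTF Dxy => /eqP ->; rewrite dag_irr. Qed.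
Let Dyx : D y x = false. Proof. exact: dag_asym. Qed.

Lemma reverse_edge_dag : is_dag D'.
Proof.
pose D0 u v := D u v && ~~ ((u == x) && (v == y)).
have D0D u v : connect D0 u v -> connect D u v.
  by apply: connect_sub => a b /andP[ab _]; exact: connect1.
(* A second directed path from [x] to [y] would enter [y] through a parent of [x], closing a
   cycle. *)
have nD0 : ~ connect D0 x y.
  case/connect_last => [/eqP|[w xw /andP[]]]; first by rewrite nxy.
  rewrite pay eqxx andbT => /orP[wx _|->//].
  by have := dD wx; rewrite D0D.
have split a b : connect D' a b -> connect D0 a b \/ connect D0 a y /\ connect D0 x b.
  move: b; apply: connect_indr => [|b c _ /orP[D0bc|/andP[/eqP -> /eqP ->]]].
  - by left; exact: connect0.
  - case=> [h|[h h']]; [left|right; split => //].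
      exact: connect_trans h (@connect1 _ D0 _ _ D0bc).
    exact: connect_trans h' (@connect1 _ D0 _ _ D0bc).
  - by case=> [h|[h _]]; right.
move=> u v /orP[D0uv|/andP[/eqP -> /eqP ->]]; apply/negP => /split.
  case=> [/D0D vu|[vy xu]]; first by case/andP: D0uv => /dD; rewrite vu.
  by apply: nD0; apply: connect_trans xu (connect_trans (@connect1 _ D0 _ _ D0uv) vy).
by case=> [|[]].
Qed.

Lemma reverse_edge_covered : covered D' y x.
Proof.
split; first by rewrite /D' /reverse_edge !eqxx orbT.
move=> z; rewrite /D' /reverse_edge (eq_sym y x) nxy !eqxx pay.
case: (eqVneq z x) => [->|_]; first by rewrite dag_irr ?nxy.
by case: (D z x); case: (z == y).
Qed.

Lemma reverse_edgeK u v : reverse_edge D' y x u v = D u v.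
Proof.
rewrite /D' /reverse_edge.
case: (eqVneq u x) => [->|_]; case: (eqVneq v y) => [->|_] /=.
- by rewrite Dxy orbT.
- by rewrite nxy; case: (D x v).
- by rewrite (eq_sym y x) nxy; case: (D u y); case: (u == y).
- rewrite andbT orbF.
  case: (eqVneq u y) => [->|_]; case: (eqVneq v x) => [->|_] //=; rewrite ?Dyx ?andbT ?orbF //.
Qed.

Let D'E u v : D u v -> (u == x) && (v == y) = false -> D' u v.
Proof. by move=> uv nE; rewrite /D' /reverse_edge uv nE. Qed.

Let D'yx : D' y x. Proof. by rewrite /D' /reverse_edge !eqxx orbT. Qed.

(** A path that reaches [x] from a parent before using [x -> y] is rerouted, since that parent also
    points to [y]. Only paths starting at [x] itself are lost, and these continue from [y]. *)
Let connect_D' v z : connect D v z -> connect D' v z \/ v = x /\ connect D' y z.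
Proof.
move: v; apply: connect_indl => [|v w vw _]; first by left; exact: connect0.
case: ((v == x) && (w == y)) / boolP => [/andP[/eqP -> /eqP ->]|/negbTE ne].
  by case=> [h|[/esym/eqP]]; [right|rewrite nxy].
case=> [h|[wx h]]; first by left; exact: connect_trans (connect1 (D'E vw ne)) h.
have vy : D v y by rewrite pay -wx vw.
have nvx : (v == x) = false by apply: contraTF vw => /eqP ->; rewrite wx dag_irr.
by left; apply: connect_trans (connect1 (D'E vy _)) h; rewrite nvx.
Qed.

Let has_desc_D' C v : has_desc D C v ->
  has_desc D' C v \/ v = x /\ has_desc D' C y.
Proof.
case/existsP => z /andP[/connect_D' [vz|[vx yz]] zC]; [left|right; split => //];
  by apply/existsP; exists z; apply/andP.
Qed.

Lemma reverse_edge_trail C a v d : trail D C a v d ->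
  exists d', trail D' C a v d'.
Proof.
pose T := trail D' C a.
(* Away from [x] and [y] a trail is copied with its flag. At these two vertices the flag may change
   under the reversal, so the invariant lists combinations of states of [D'] that together can
   imitate every continuation of the trail. *)
pose inv v d :=
  if v == x then
    if d then T x true /\ T y true
    else [\/ T x false, [/\ y \notin C, T x true & T y false] |
             [/\ T x true, T y true & has_desc D' C y]]
  else if v == y then
    if d then [\/ T x true /\ T y true, [/\ x \notin C, T x false & T y false] |
                  [/\ y \notin C, T x true & T y false]]
    else T y false
  else T v d.
suff H w e : trail D C a w e -> inv w e.
  move/H; rewrite /inv; case: eqVneq => [->|_].
    by case: d => [[? _]|[?|[_ ? _]|[? _ _]]]; eexists; eassumption.
  case: eqVneq => [->|_]; last by exists d.
  by case: d => [[[_ ?]|[_ _ ?]|[_ _ ?]]|?]; eexists; eassumption.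
have nyx : (y == x) = false by rewrite eq_sym.
elim=> {w e} [|u e w _ IH uC Duw|u e w _ IH pu Dwu].
- have T0 : T a false by exact: trail_start.
  rewrite /inv; case: eqVneq => [ax|_]; first by apply: Or31; rewrite -ax.
  by case: eqVneq => [ay|//]; rewrite -ay.
- have nwu : (w == u) = false by apply: contraTF Duw => /eqP ->; rewrite dag_irr.
  case: (eqVneq u x) => ux; [subst u|case: (eqVneq u y) => uy; [subst u|]].
  + move: IH; rewrite /inv eqxx nwu.
    case: (eqVneq w y) => [_|wy].
      case: e => [h|[h|h|[? ? _]]]; [exact: Or31| |exact: Or33|exact: Or31].
      by apply: Or32; split => //; exact: trail_bwd h _ D'yx.
    have D'w : D' x w by apply: D'E => //; rewrite (negbTE wy) andbF.
    by case: e => [[h _]|[h|[_ h _]|[h _ _]]]; exact: trail_fwd h uC D'w.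
  + have wx : (w == x) = false by apply: contraTF Duw => /eqP ->; rewrite Dyx.
    have D'w : D' y w by apply: D'E => //; rewrite nyx.
    move: IH; rewrite /inv wx nwu nyx eqxx.
    by case: e => [[[_ h]|[_ _ h]|[_ _ h]]|h]; exact: trail_fwd h uC D'w.
  + move: IH; rewrite /inv (negbTE ux) (negbTE uy) => h.
    case: (eqVneq w x) => [wx|wx].
      rewrite wx in Duw; split.
        by apply: trail_fwd h uC (D'E Duw _); rewrite (negbTE ux).
      by apply: trail_fwd h uC (D'E _ _); rewrite ?pay ?Duw// (negbTE ux).
    case: (eqVneq w y) => [wy|wy].
      rewrite wy pay (negbTE ux) orbF in Duw; apply: Or31; split.
        by apply: trail_fwd h uC (D'E Duw _); rewrite (negbTE ux).
      by apply: trail_fwd h uC (D'E _ _); rewrite ?pay ?Duw// (negbTE ux).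
    by apply: trail_fwd h uC (D'E Duw _); rewrite (negbTE ux).
- have nwu : (w == u) = false by apply: contraTF Dwu => /eqP ->; rewrite dag_irr.
  case: (eqVneq u x) => ux; [subst u|case: (eqVneq u y) => uy; [subst u|]].
  + have wy : (w == y) = false by apply: contraTF Dwu => /eqP ->; rewrite Dyx.
    have D'wx : D' w x by apply: D'E => //; rewrite nwu.
    have D'wy : D' w y by apply: D'E; rewrite ?pay ?Dwu// nwu.
    move: IH; rewrite /inv eqxx nwu wy.
    case: e pu => [hd [tx ty]|xC].
      by case: (has_desc_D' hd) => [h|[_ h]]; [exact: trail_bwd tx _ D'wx|
        exact: trail_bwd ty _ D'wy].
    case=> [h|[yC _ h]|[_ h hd]]; [exact: trail_bwd h _ D'wx|exact: trail_bwd h _ D'wy|].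
    exact: trail_bwd h _ D'wy.
  + have hdy : has_desc D C y -> has_desc D' C y.
      by case/has_desc_D' => // -[/eqP]; rewrite nyx.
    move: IH; rewrite /inv nyx eqxx nwu.
    case: (eqVneq w x) => [wx|wx].
      case: e pu => [hd [[tx ty]|[_ tx _]|h]|yC h].
      * by apply: Or33; split => //; exact: hdy.
      * exact: Or31.
      * exact: Or32.
      * by apply: Or32; split => //; exact: trail_fwd h yC D'yx.
    have D'wy : D' w y by apply: D'E; rewrite // (negbTE wx).
    have D'wx : D' w x.
      by move: Dwu; rewrite pay (negbTE wx) orbF => Dwx; apply: D'E => //; rewrite (negbTE wx).
    case: e pu => [hd [[_ h]|[xC h _]|[yC _ h]]|yC h].
    * by apply: trail_bwd h _ D'wy; exact: hdy.
    * exact: trail_bwd h _ D'wx.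
    * exact: trail_bwd h _ D'wy.
    * exact: trail_bwd h _ D'wy.
  + have pu' : pass D' C u e.
      case: e pu {IH} => // /has_desc_D' [//|[/eqP]]; by rewrite (negbTE ux).
    have D'wu : D' w u by apply: D'E => //; rewrite (negbTE uy) andbF.
    move: IH; rewrite /inv (negbTE ux) (negbTE uy) => h.
    have := trail_bwd h pu' D'wu.
    case: (eqVneq w x) => [->|_]; first by move=> ?; exact: Or31.
    by case: (eqVneq w y) => [->|_].
Qed.

End CoveredReversal.

Lemma reverse_edge_dsep D x y (A B C : {set 'I_p}) : is_dag D -> covered D x y ->
  disjoint (mem A) (mem C) ->
  dsep D A B C <-> dsep (reverse_edge D x y) A B C.
Proof.
move=> dD cov dAC; have dD' := reverse_edge_dag dD cov.
have cov' := reverse_edge_covered dD cov.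
rewrite !dsep_trailP//; split=> H a b d aA bB; last first.
  by move=> /(reverse_edge_trail dD cov) [d']; exact: H.
move=> /(reverse_edge_trail dD' cov') [d'].
have -> : reverse_edge (reverse_edge D x y) y x = D.
  by apply/funext => i; apply/funext => j; exact: reverse_edgeK.
exact: H.
Qed.

(* Chickering's choice of edge: [y] is minimal among the heads of disagreeing
   edges, then [x] is maximal among their tails. *)
Lemma exists_covered_disagreement D1 D2 u0 v0 : is_dag D1 -> is_dag D2 ->
  skel D1 =2 skel D2 ->
  (forall i k j, dag_vstruct D1 i k j -> dag_vstruct D2 i k j) ->
  (forall i k j, dag_vstruct D2 i k j -> dag_vstruct D1 i k j) ->
  D1 u0 v0 -> D2 v0 u0 ->
  exists x y, covered D1 x y /\ D2 y x.
Proof.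
move=> d1 d2 sk v12 v21 u0v0 v0u0.
pose P y := [exists x, D1 x y && D2 y x].
have P0 : P v0 by apply/existsP; exists u0; rewrite u0v0.
case: (@arg_minnP _ v0 P (dag_rank D1) P0) => y /existsP[x1 Q1] ymin.
case: (@arg_maxnP _ x1 (fun x => D1 x y && D2 y x) (dag_rank D1) Q1) => x /andP[D1xy D2yx] xmax.
have agree z w : D1 z w -> (dag_rank D1 w < dag_rank D1 y)%N -> D2 z w.
  move=> zw wy; have : skel D2 z w by rewrite -sk /skel zw.
  case/orP => // wz; move: wy; rewrite ltnNge ymin//.
  by apply/existsP; exists z; rewrite zw.
have rxy := dag_rank_lt d1 D1xy.
have cyc a b c : D2 a b -> D2 b c -> D2 c a -> False.
  by move=> ab bc /d2; rewrite (connect_trans (connect1 ab) (connect1 bc)).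
exists x, y; split => //; split => // z; apply/idP/orP => [zy|[zx|/eqP -> //]].
  have [->|zx] := eqVneq z x; [by right|left].
  have [szx|nzx] := boolP (skel D1 z x); last first.
    have [] : dag_vstruct D2 z y x by apply: v12.
    by rewrite (dag_asym d2 D2yx).
  (* Maximality of [x] gives [z -> y] in [D2], minimality of [y] gives [x -> z]; together with
     [y -> x] they form a cycle of [D2]. *)
  case/orP: szx => // xz; exfalso.
  have D2zy : D2 z y.
    have : skel D2 z y by rewrite -sk /skel zy.
    case/orP => // yz; have := xmax z; rewrite zy yz => /(_ isT) /=.
    by rewrite leqNgt (dag_rank_lt d1 xz).
  have D2xz := agree _ _ xz (dag_rank_lt d1 zy).
  exact: cyc D2xz D2zy D2yx.
have D2zx := agree _ _ zx rxy.
have zny : z != y by apply: contraTneq zx => ->; rewrite (dag_asym d1 D1xy).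
have [szy|nzy] := boolP (skel D1 z y); last first.
  have [_] : dag_vstruct D1 z x y.
    by apply: v21; split; rewrite -?sk.
  by rewrite (dag_asym d1 D1xy).
case/orP: szy => // yz.
by have := d1 _ _ zx; rewrite (connect_trans (connect1 D1xy) (connect1 yz)).
Qed.

End Separation.

(** * Rigidity of the potential *)
Local Open Scope ring_scope.

Section SecondDifference.
Context {R : realType}.
Implicit Types (f : R -> R) (u h x : R).

Definition second_diff f u h := f (u + h) + f (u - h) - 2 * f u.

(** Differentiating f(u+h) + f(u-h) = 2 f(u) in h at h = u gives f'(2u) = f'(0), so the derivative
    is constant. *)
Lemma second_diff_affine f : (forall x, derivable f x 1) ->
  (forall u h, second_diff f u h = 0) -> forall x, f x = f 0 + x * (f 1 - f 0).
Proof.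
move=> df f0.
have isf y : is_derive y (1 : R) f (derive1 f y) by rewrite derive1E; exact: derivableP.
have f'E (u : R) : derive1 f (u + u) = derive1 f 0.
  pose l h : R := u + h; pose r h : R := u - h.
  have dl : is_derive u (1 : R) l 1.
    by rewrite /l; apply: is_derive_eq; rewrite add0r mulr1.
  have dr : is_derive u (1 : R) r (- 1).
    by rewrite /r; apply: is_derive_eq; rewrite add0r mul1r.
  have dk : is_derive u (1 : R) ((f \o l) \+ (f \o r))
      (derive1 f (u + u) * 1 + derive1 f (u - u) * - 1).
    by apply: is_deriveD; exact: is_derive1_comp.
  have kE : (f \o l) \+ (f \o r) = cst (2 * f u).
    by apply/funext => h; have /eqP := f0 u h; rewrite /second_diff subr_eq0 => /eqP.
  have := @derive_val _ _ _ _ _ _ _ dk; rewrite kE derive_cst.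
  by rewrite subrr; lra.
pose g x := f x - x * derive1 f 0.
have dg x : is_derive x (1 : R) g 0.
  apply: is_derive_eq; rewrite scaler0 add0r -{1}(f'E (x / 2)) -splitr.
  by rewrite /GRing.scale /= mulr1 -[X in derive1 f X](_ : x / 2 + x / 2 = x) ?f'E ?subrr// -splitr.
have gE x : g x = g 0 by exact: is_derive_0_is_cst.
move=> x; have kE : derive1 f 0 = f 1 - f 0 by have := gE 1; rewrite /g; lra.
by have := gE x; rewrite /g kE mul0r; lra.
Qed.

End SecondDifference.

Lemma derivable_bigsum (R : realType) (I : finType) (P : pred I) (F : I -> R -> R)
    (x : R) :
  (forall i, derivable (F i) x (1 : R)) ->
  derivable (fun s => \sum_(i | P i) F i s) x (1 : R).
Proof.
move=> dF; elim: (index_enum I) => [|i r IH].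
  by under eq_fun do rewrite big_nil; exact: derivable_cst.
under eq_fun do rewrite big_cons.
by case: (P i) => //; apply: derivableD; [exact: dF|exact: IH].
Qed.

Section Dot.
Context {R : realType} {I : finType}.
Implicit Types (z w v : I -> R).

Definition dot z w := \sum_l z l * w l.

Lemma dotC z w : dot z w = dot w z.
Proof. by apply: eq_bigr => l _; rewrite mulrC. Qed.

Lemma dotDr z w v : dot z (fun l => w l + v l) = dot z w + dot z v.
Proof. by rewrite /dot -big_split; apply: eq_bigr => l _; rewrite mulrDr. Qed.

Lemma dotZr k z w : dot z (fun l => k * w l) = k * dot z w.
Proof. by rewrite /dot mulr_sumr; apply: eq_bigr => l _; rewrite mulrCA. Qed.

Lemma dotBr z w v : dot z (fun l => w l - v l) = dot z w - dot z v.
Proof. by rewrite /dot -sumrB; apply: eq_bigr => l _; rewrite mulrBr. Qed.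

Lemma dotDl z w v : dot (fun l => w l + v l) z = dot w z + dot v z.
Proof. by rewrite dotC dotDr !(dotC z). Qed.

Lemma dotZl k z w : dot (fun l => k * w l) z = k * dot w z.
Proof. by rewrite dotC dotZr (dotC z). Qed.

Lemma dotBl z w v : dot (fun l => w l - v l) z = dot w z - dot v z.
Proof. by rewrite dotC dotBr !(dotC z). Qed.

Lemma dot_sumr (J : finType) (P : pred J) z (F : J -> I -> R) :
  dot z (fun l => \sum_(j | P j) F j l) = \sum_(j | P j) dot z (F j).
Proof.
by rewrite /dot exchange_big /=; apply: eq_bigr => l _; rewrite mulr_sumr.
Qed.

Lemma dot_eq0 z : dot z z = 0 -> forall l, z l = 0.
Proof.
move=> /eqP; rewrite psumr_eq0 => [/allP h l|l _]; last by rewrite -expr2 sqr_ge0.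
by have := h l (mem_index_enum l); rewrite /= mulf_eq0 orbb => /eqP.
Qed.

(** Orthogonal projection onto the complement of [v]. *)
Definition oproj v w : I -> R := fun l => w l - dot w v / dot v v * v l.

Lemma oprojD v w w' :
  oproj v (fun l => w l + w' l) = fun l => oproj v w l + oproj v w' l.
Proof. by apply/funext => l; rewrite /oproj dotDl; ring. Qed.

Lemma oproj_sum (J : finType) (P : pred J) v (F : J -> I -> R) :
  oproj v (fun l => \sum_(j | P j) F j l) = fun l => \sum_(j | P j) oproj v (F j) l.
Proof.
apply/funext => l; rewrite /oproj sumrB; congr (_ - _).
by rewrite dotC dot_sumr -!mulr_suml; under eq_bigr do rewrite dotC.
Qed.

Lemma dot_oprojC v z w : dot (oproj v z) w = dot z (oproj v w).
Proof. by rewrite /oproj dotBl dotBr dotZl dotZr (dotC v w); ring. Qed.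

Lemma dot_oproj v w : dot v v != 0 -> dot (oproj v w) (oproj v w) =
  dot w w - dot w v ^+ 2 / dot v v.
Proof.
by move=> v0; rewrite /oproj dotBl !dotBr !dotZl !dotZr (dotC v w); field.
Qed.

Definition second_diffv (g : R -> I -> R) u h : I -> R :=
  fun l => second_diff (fun s => g s l) u h.

Lemma dot_second_diffv z (g : R -> I -> R) u h :
  dot z (second_diffv g u h) = second_diff (fun s => dot z (g s)) u h.
Proof.
rewrite /second_diffv /second_diff dotBr dotDr; congr (_ + _ - _).
by rewrite -dotZr.
Qed.

End Dot.

(** * Minimising an additive square over one coordinate *)

Section Elimination.
Context {R : realType} {I : finType}.
Implicit Types (E : {set I}) (c z : I -> R) (g : I -> R -> I -> R).
Variable g0 : I -> R -> I -> R.

(* [S] is the potential left after minimising over the coordinates in [E], written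
   as the square norm of an additive map. The third clause is what nondegeneracy
   of triangular maps becomes under orthogonal projection; the last one says
   that only the directions of the eliminated coordinates were projected away. *)
Record additive_square E c g (S : (I -> R) -> R) : Prop := AdditiveSquare {
  as_derivable : forall m l u, derivable (fun s => g m s l) u (1 : R);
  as_square : forall x, let F l := c l + \sum_(m | m \notin E) g m (x m) l in
     S x = dot F F;
  as_span : forall t z, t \notin E ->
     (forall m, m \notin E -> m != t -> forall u v, dot z (g m u) = dot z (g m v)) ->
     forall u h, dot z (second_diffv (g t) u h) = 0;
  as_lift : forall z, (forall m, m \in E -> dot z (g0 m 1) = dot z (g0 m 0)) ->
     forall m u, dot z (g m u) = dot z (g0 m u) }.

Definition upd_fun (x : I -> R) t (a : R) : I -> R := fun i => if i == t then a else x i.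

Lemma upd_fun_eq x t a : upd_fun x t a t = a.
Proof. by rewrite /upd_fun eqxx. Qed.

Lemma upd_fun_neq x t a i : i != t -> upd_fun x t a i = x i.
Proof. by rewrite /upd_fun => /negbTE ->. Qed.

(** The hypothesis makes [S] quadratic in [x t] with a leading coefficient that is the same for all
    other coordinates. This rigidity forces [g t] to be affine; [S'] is then the minimum of [S] over
    [x t], that is, the square norm after projecting away the slope of [g t]. *)
Lemma eliminate E c g S t (d : R) (A S' : (I -> R) -> R) :
  additive_square E c g S -> t \notin E -> d != 0 ->
  (forall x, S x = (d * x t - A x) ^+ 2 + S' x) ->
  (forall x a, A (upd_fun x t a) = A x) -> (forall x a, S' (upd_fun x t a) = S' x) ->
  (forall u h l, second_diffv (g t) u h l = 0) /\
  exists c' g', additive_square (t |: E) c' g' S'.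
Proof.
move=> [dg sq sp li] tE d0 SE At S't.
have [b bE] : exists b : (I -> R) -> I -> R, forall x l,
    b x l = c l + \sum_(m | (m \notin E) && (m != t)) g m (x m) l by eexists.
have bt x a l : b (upd_fun x t a) l = b x l.
  rewrite !bE; congr (_ + _); apply: eq_bigr => m /andP[_ mt].
  by rewrite upd_fun_neq.
have Sb x a : dot (b x) (b x) + 2 * dot (b x) (g t a) + dot (g t a) (g t a) =
    (d * a - A x) ^+ 2 + S' x.
  have := SE (upd_fun x t a); rewrite At S't upd_fun_eq => <-.
  rewrite sq /=.
  rewrite [in RHS](_ : (fun l => _) = (fun l => b x l + g t a l)).
    by rewrite dotDl !dotDr (dotC (g t a) (b x)); ring.
  apply/funext => l; rewrite (bigD1 t)//= upd_fun_eq -(bt x a) bE; ring.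
have D2b x u h : 2 * dot (b x) (second_diffv (g t) u h) =
    2 * d ^+ 2 * h ^+ 2 - second_diff (fun a => dot (g t a) (g t a)) u h.
  rewrite dot_second_diffv /second_diff.
  have := Sb x (u + h); have := Sb x (u - h); have := Sb x u; lra.
have D20 u h l : second_diffv (g t) u h l = 0.
  (* [as_span] is used with the second difference itself as [z], which makes it orthogonal to
     itself. *)
  move: l; apply: dot_eq0; apply: sp => // m mE mt a a'.
  pose x0 : I -> R := fun=> 0.
  have bu s : dot (b (upd_fun x0 m s)) (second_diffv (g t) u h) =
     dot (fun l => c l + \sum_(k | (k \notin E) && (k != t) && (k != m)) g k 0 l)
         (second_diffv (g t) u h) + dot (second_diffv (g t) u h) (g m s).
    rewrite (dotC _ (g m s)) -dotDl; congr dot; apply/funext => l.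
    rewrite bE (bigD1 m) ?mE//= upd_fun_eq -!addrA; congr (_ + _).
    rewrite addrC; congr (_ + _); apply: eq_bigr => k /andP[_ km].
    by rewrite upd_fun_neq.
  have := D2b (upd_fun x0 m a) u h; have := D2b (upd_fun x0 m a') u h.
  by rewrite !bu; lra.
split => //.
have [v vE] : exists v, v = fun l => g t 1 l - g t 0 l by eexists.
have gtE s : g t s = fun l => g t 0 l + s * v l.
  rewrite vE; apply/funext => l; apply: (second_diff_affine (dg t l)) => u h; exact: D20.
pose b' x : I -> R := fun l => b x l + g t 0 l.
have Sb' x a : dot (b' x) (b' x) + 2 * a * dot (b' x) v + a ^+ 2 * dot v v =
    (d * a - A x) ^+ 2 + S' x.
  rewrite -Sb gtE /b' !(dotDl, dotDr, dotZl, dotZr) (dotC (g t 0) (b x)).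
  by rewrite (dotC v (g t 0)); ring.
(* Both sides of [Sb'] are quadratic polynomials in [a]; the values at 0, 1 and -1 identify their
   coefficients. *)
have [vv bv S'E] : [/\ dot v v = d ^+ 2, forall x, dot (b' x) v = - (d * A x) &
    forall x, S' x = dot (b' x) (b' x) - A x ^+ 2].
  split=> [|x|x].
  - have := Sb' (fun=> 0) 0; have := Sb' (fun=> 0) 1; have := Sb' (fun=> 0) (-1); lra.
  - have := Sb' x 0; have := Sb' x 1; have := Sb' x (-1); lra.
  - have := Sb' x 0; lra.
have vv0 : dot v v != 0 by rewrite vv expf_neq0.
exists (oproj v (fun l => c l + g t 0 l)), (fun m s => oproj v (g m s)); split.
- move=> m l u; rewrite /oproj; apply: derivableB; first exact: dg.
  apply: derivableM; last exact: derivable_cst.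
  apply: derivableM; last exact: derivable_cst.
  apply: derivable_bigsum => k; apply: derivableM; last exact: derivable_cst.
  exact: dg.
- move=> x /=.
  rewrite (_ : (fun l => _) = oproj v (b' x)).
    by rewrite dot_oproj// S'E bv vv; field.
  have -> : b' x = fun l => (c l + g t 0 l) + \sum_(m | m \notin t |: E) g m (x m) l.
    apply/funext => l; rewrite /b' bE addrAC; congr (_ + _).
    by apply: eq_bigl => m; rewrite !inE negb_or andbC.
  by rewrite [RHS]oprojD oproj_sum.
- move=> m z; rewrite !inE negb_or => /andP[mt mE] zm u h.
  pose z' := oproj v z.
  (* Moving the projection from the functions to [z] reduces to the old condition; its new
     requirement, for the coordinate [t], holds because the slope [v] is projected away. *)
  have z'E : dot z' (second_diffv (g m) u h) = 0.
    apply: sp => // k kE km a a'; rewrite /z' !dot_oprojC.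
    have [->|kt] := eqVneq k t; last by apply: zm; rewrite ?inE ?negb_or ?kt.
    have gtp s : dot z (oproj v (g t s)) = dot z (oproj v (g t 0)).
      rewrite gtE /oproj !dotBr !dotDr !dotZr !dotDl dotZl; by field.
    by rewrite gtp [RHS]gtp.
  rewrite -z'E !dot_second_diffv /second_diff /z' !dot_oprojC; ring.
- move=> z zE m u.
  have zvE : forall k, k \in E -> dot z (g0 k 1) = dot z (g0 k 0).
    by move=> k kE; apply: zE; rewrite !inE kE orbT.
  (* A vector orthogonal to the increments of the eliminated coordinates is orthogonal to [v], so
     the projection leaves its pairings unchanged. *)
  have zv : dot z v = 0.
    by rewrite vE dotBr !li// zE ?subrr// !inE eqxx.
  by rewrite /oproj dotBr dotZr zv mulr0 subr0 li.
Qed.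

End Elimination.

(** * Comparing the residuals of two DAGs *)

Section Rigidity.
Context {R : realType} {p : nat}.
Implicit Types (D : rel 'I_p) (mu sigma : 'I_p -> R) (f : 'I_p -> 'I_p -> R -> R)
  (x : 'I_p -> R).

Definition residual D mu f x (j : 'I_p) := x j - mu j - \sum_(i | D i j) f j i (x i).

Lemma residual_upd D mu f x t a l : l != t -> ~~ D t l ->
  residual D mu f (upd_fun x t a) l = residual D mu f x l.
Proof.
move=> lt Dtl; rewrite /residual upd_fun_neq//; congr (_ - _).
apply: eq_bigr => i Dil; rewrite upd_fun_neq//.
by apply: contraNneq Dtl => <-.
Qed.

(** A remaining coordinate of maximal rank has no remaining child, so it occurs in a single
    remaining residual, and linearly: exactly the shape that [eliminate] requires. *)
Lemma eliminate_above D mu f sigma (k : R) i g0 c0 : is_dag D ->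
  (forall j, 0 < sigma j) ->
  additive_square g0 finset.set0 c0 g0
    (fun x => \sum_l (residual D mu f x l / sigma l) ^+ 2 + k) ->
  exists E c g S, [/\ additive_square g0 E c g S,
    (forall t, t \in E -> (dag_rank D i < dag_rank D t)%N) &
    forall u h l, second_diffv (g i) u h l = 0].
Proof.
move=> dD s0; set G := fun l x => (residual D mu f x l / sigma l) ^+ 2.
have GE (E : {set 'I_p}) t : t \notin E ->
    (forall m, m \notin E -> (dag_rank D m <= dag_rank D t)%N) ->
    exists (A : ('I_p -> R) -> R),
    let S' x := \sum_(l | l \notin t |: E) G l x + k in
    [/\ forall x, \sum_(l | l \notin E) G l x + k = ((sigma t)^-1 * x t - A x) ^+ 2 + S' x,
        forall x a, A (upd_fun x t a) = A x & forall x a, S' (upd_fun x t a) = S' x].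
  move=> tE tmax.
  exists (fun x => (mu t + \sum_(i | D i t) f t i (x i)) / sigma t) => S'; split=> x.
  - rewrite (bigD1 t)//= -addrA; congr (_ + _).
      by rewrite /G /residual; congr (_ ^+ 2); ring.
    by congr (_ + _); apply: eq_bigl => l; rewrite !inE negb_or andbC.
  - move=> a; congr ((_ + _) / _); apply: eq_bigr => m Dmt.
    by rewrite upd_fun_neq//; apply: contraTneq Dmt => ->; rewrite dag_irr.
  - move=> a; congr (_ + _); apply: eq_bigr => l; rewrite !inE negb_or => /andP[lt lE].
    rewrite /G residual_upd//; apply/negP => /(dag_rank_lt dD).
    by rewrite ltnNge tmax.
suff H n (E : {set 'I_p}) c g : (#|~: E| <= n)%N ->
    (forall t, t \in E -> (dag_rank D i < dag_rank D t)%N) ->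
    additive_square g0 E c g (fun x => \sum_(l | l \notin E) G l x + k) ->
    exists E c g S, [/\ additive_square g0 E c g S,
    (forall t, t \in E -> (dag_rank D i < dag_rank D t)%N) &
    forall u h l, second_diffv (g i) u h l = 0].
  move=> h; apply: (H #|~: finset.set0 : {set 'I_p}| finset.set0 c0 g0) => //.
    by move=> t; rewrite inE.
  by under eq_fun do under eq_bigl do rewrite finset.in_set0.
elim: n E c g => [|n IH] E c g En Ei as_E.
  have iE : i \in E.
    by move: En; rewrite leqn0 cards_eq0 => /eqP/setP/(_ i); rewrite !inE => /negbFE.
  by have := Ei _ iE; rewrite ltnn.
have iE : i \notin E by apply/negP => /Ei; rewrite ltnn.
case: (@arg_maxnP _ i (fun m => m \notin E) (dag_rank D) iE) => t tE tmax.
have {}tmax m : m \notin E -> (dag_rank D m <= dag_rank D t)%N by exact: tmax.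
have step s : s \notin E -> (forall m, m \notin E -> (dag_rank D m <= dag_rank D s)%N) ->
    (forall u h l, second_diffv (g s) u h l = 0) /\ exists c' g',
    additive_square g0 (s |: E) c' g' (fun x => \sum_(l | l \notin s |: E) G l x + k).
  move=> sE smax; have [A [SE At St]] := GE E s sE smax.
  by apply: (eliminate as_E sE _ SE At St); rewrite invr_neq0// gt_eqF.
(* Once [i] has maximal rank the elimination step is applied to it only for the affineness of [g i];
   the projection is discarded, so [E] stays strictly above [i]. *)
have [it|it] := leqP (dag_rank D t) (dag_rank D i).
  exists E, c, g; eexists; split; [exact: as_E|exact: Ei|].
  by apply: (step i iE _).1 => m /tmax /leq_trans; exact.
have [_ [c' [g' as']]] := step t tE tmax.
apply: IH as'.
  rewrite -ltnS; apply: leq_trans En; apply: proper_card; apply/properP; split.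
    by apply/fintype.subsetP => m; rewrite !inE negb_or => /andP[].
  by exists t; rewrite !inE ?tE// eqxx.
by move=> s; rewrite !inE => /orP[/eqP -> //|]; exact: Ei.
Qed.

Section Encoding.
Variables (D : rel 'I_p) (mu : 'I_p -> R) (f : 'I_p -> 'I_p -> R -> R) (sigma : 'I_p -> R).
Hypotheses (dD : is_dag D) (s0 : forall j, 0 < sigma j).
Hypothesis df : forall i j, D i j -> forall u : R, derivable (f j i) u (1 : R).

(** The contribution of coordinate [m], at value [s], to the vector of standardised residuals, which
    is additive in the coordinates. *)
Definition edge_vec (m : 'I_p) (s : R) (l : 'I_p) : R :=
  ((if l == m then s else 0) - (if D m l then f l m s else 0)) / sigma l.

Lemma second_diff_edge_vec m u h l : second_diffv (edge_vec m) u h l =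
  - (if D m l then second_diff (f l m) u h else 0) / sigma l.
Proof.
rewrite /second_diffv /second_diff /edge_vec.
by case: (l == m); case: (D m l); ring.
Qed.

Lemma edge_vec_support m u v l : l != m -> ~~ D m l -> edge_vec m u l = edge_vec m v l.
Proof. by rewrite /edge_vec => /negbTE -> /negbTE ->. Qed.

(** Separating the diagonal entry from the children of [m] exhibits the orthogonality conditions on
    [z] as a triangular system. *)
Lemma dot_edge_vec z m u v :
  dot z (edge_vec m u) - dot z (edge_vec m v) = z m * (u - v) / sigma m
    + \sum_(l | D m l) z l * (edge_vec m u l - edge_vec m v l).
Proof.
rewrite -dotBr /dot (bigD1 m)//= {1 2}/edge_vec eqxx dag_irr// !subr0.
congr (_ + _); first by ring.
rewrite big_mkcond [RHS]big_mkcond; apply: eq_bigr => l _.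
case: eqVneq => [->|lm] /=; first by rewrite dag_irr.
by case: ifPn => // Dml; rewrite (edge_vec_support u v lm Dml) subrr mulr0.
Qed.

Lemma edge_vec_additive_square :
  additive_square edge_vec finset.set0 (fun l => - mu l / sigma l) edge_vec
    (fun x => \sum_l (residual D mu f x l / sigma l) ^+ 2).
Proof.
split.
- move=> m l u; rewrite /edge_vec; apply: derivableM; last exact: derivable_cst.
  apply: derivableB; first by case: (l == m).
  by case Dml: (D m l); [exact: df|exact: derivable_cst].
- move=> x; apply: eq_bigr => l _; rewrite -expr2; congr (_ ^+ 2).
  under eq_bigl do rewrite finset.in_set0.
  rewrite /edge_vec -mulr_suml sumrB -!big_mkcond (big_pred1 l) => [|m]; last by rewrite /= eq_sym.
  rewrite /residual.
  by rewrite -mulrDl; congr (_ / _); ring.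
- move=> t z _ zm u h; rewrite dotC /dot; apply: big1 => l _.
  rewrite second_diff_edge_vec; case: ifPn => [Dtl|]; last by rewrite oppr0 !mul0r.
  (* The second difference of [edge_vec t] lives on the children of [t]. The condition of each
     proper descendant of [t] makes its entry of [z] vanish once those of its children do; the
     induction goes down from ranks above [p], which do not occur. *)
  suff H n l' : (p < dag_rank D l' + n)%N -> connect D t l' -> l' != t -> z l' = 0.
    have -> : z l = 0; last by rewrite mulr0.
    apply: (H p.+1); [by rewrite addnS ltnS leq_addl|exact: connect1|].
    by apply: contraTneq Dtl => ->; rewrite dag_irr.
  elim: n l' => [|n IH] m pm tm mt.
    move: pm; rewrite addn0 ltnNge; case/negP.
    by rewrite -[leqRHS]card_ord max_card.
  have := dot_edge_vec z m 1 0; rewrite (zm m _ mt 1 0) ?finset.in_set0// subrr big1.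
    rewrite addr0 subr0 mulr1 => /esym/eqP; rewrite mulf_eq0 invr_eq0 => /orP[/eqP//|].
    by rewrite gt_eqF.
  move=> l' Dml'; rewrite IH ?mul0r//.
  - by apply: leq_trans pm _; rewrite addnS -addSn leq_add2r dag_rank_lt.
  - exact: connect_trans tm (connect1 Dml').
  - by apply: contraTneq tm => <-; exact: dD.
- by [].
Qed.

(* The system is triangular: solve for [z] along decreasing rank in [D]. *)
Lemma exists_dual_vector (E : {set 'I_p}) j : j \notin E ->
  exists z : 'I_p -> R, [/\ z j = 1, forall l, z l != 0 -> connect D l j &
    forall t, t \in E -> dot z (edge_vec t 1) = dot z (edge_vec t 0)].
Proof.
move=> jE.
suff H n : exists z : 'I_p -> R, [/\ z j = 1,
    forall l, z l != 0 -> connect D l j & forall t, t \in E -> (p < dag_rank D t + n)%N ->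
    dot z (edge_vec t 1) = dot z (edge_vec t 0)].
  have [z [zj zs zE]] := H p.+1.
  by exists z; split => // t tE; apply: zE => //; rewrite addnS ltnS leq_addl.
elim: n => [|n [z [zj zs zE]]].
  exists (fun l => (l == j)%:R); split; first by rewrite eqxx.
    by move=> l; case: (eqVneq l j) => [->|_]; rewrite ?eqxx ?connect0.
  move=> t _; rewrite addn0 ltnNge; case/negP.
  by rewrite -[leqRHS]card_ord max_card.
(* At rank [p - n] the diagonal entry is chosen to solve the equation of [l]. Equations of higher
   rank involve only entries of higher rank and stay solved; [j] is outside [E], so its entry
   remains 1. *)
pose z' l := if (l \in E) && (dag_rank D l + n == p)%N then
   - sigma l * \sum_(m | D l m) z m * (edge_vec l 1 m - edge_vec l 0 m) else z l.
have z'E t m : (p < dag_rank D t + n.+1)%N -> D t m -> z' m = z m.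
  move=> pt /(dag_rank_lt dD) tm; rewrite /z'.
  by case: eqP => [|_]; [lia|rewrite andbF].
exists z'; split.
- by rewrite /z' (negbTE jE).
- move=> l; rewrite /z'; case: ifP => [_ nz|_]; last exact: zs.
  have [m [Dlm zm]] : exists m, D l m /\ z m != 0.
    apply: contra_notP (negP nz) => H; rewrite big1 ?mulr0// => m Dlm.
    have [->|zm] := eqVneq (z m) 0; first by rewrite mul0r.
    by case: H; exists m.
  exact: connect_trans (connect1 Dlm) (zs _ zm).
- move=> t tE pt; apply/eqP; rewrite -subr_eq0 dot_edge_vec subr0 mulr1.
  under eq_bigr => m Dtm do rewrite (z'E t m pt Dtm).
  have [e|ne] := eqVneq (dag_rank D t + n)%N p.
    by rewrite /z' tE e eqxx /=; apply/eqP; field; rewrite gt_eqF.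
  have {}pt : (p < dag_rank D t + n)%N by lia.
  rewrite /z' tE (negbTE ne) /=.
  have /eqP := zE t tE pt; rewrite -subr_eq0 dot_edge_vec subr0 mulr1.
  by [].
Qed.

End Encoding.

(** Elimination in the order of [D2] above [i] spares [j], because [j -> i] there. The dual vector
    at [j], orthogonal to what was eliminated, pairs equally with the projected function of [i] and
    with its original edge vector; affineness of the former thus reaches the latter. *)
Theorem covered_edge_affine D1 D2 mu1 mu2 f1 f2 sigma1 sigma2 (k : R) i j :
  is_dag D1 -> is_dag D2 ->
  (forall l, 0 < sigma1 l) -> (forall l, 0 < sigma2 l) ->
  (forall i j, D1 i j -> forall u : R, derivable (f1 j i) u (1 : R)) ->
  (forall x, \sum_l (residual D1 mu1 f1 x l / sigma1 l) ^+ 2 =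
             \sum_l (residual D2 mu2 f2 x l / sigma2 l) ^+ 2 + k) ->
  covered D1 i j -> D2 j i ->
  forall u : R, f1 j i u = f1 j i 0 + u * (f1 j i 1 - f1 j i 0).
Proof.
move=> d1 d2 s1 s2 df1 e [Dij cov] Dji.
have as0 := edge_vec_additive_square mu1 d1 s1 df1.
rewrite (funext e) in as0.
have [E [c [g [S [[_ _ _ li] Ei D2g]]]]] := eliminate_above i d2 s2 as0.
have jE : j \notin E.
  by apply/negP => /Ei; rewrite ltnNge (ltnW (dag_rank_lt d2 Dji)).
have [z [zj zs zE]] := exists_dual_vector f1 d1 s1 jE.
apply: second_diff_affine => [u|u h]; first exact: df1.
have : dot z (second_diffv (edge_vec D1 f1 sigma1 i) u h) = 0.
  rewrite dot_second_diffv /second_diff -!(li z zE).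
  have := dot_second_diffv z (g i) u h; rewrite /second_diff => <-.
  by rewrite dotC /dot big1// => l _; rewrite D2g mul0r.
(* Only the entry [j] survives: a child [l] of [i], other than [j], that leads to [j] would enter it
   through [i] or a parent of [i], since the edge is covered, and close a cycle. *)
rewrite /dot (bigD1 j)//= big1 => [|l lj]; last first.
  rewrite second_diff_edge_vec; case: ifPn => [Dil|]; last by rewrite oppr0 mul0r mulr0.
  have [->|/zs lcj] := eqVneq (z l) 0; first by rewrite mul0r.
  case: (connect_last lcj) => [/eqP|[w lw]]; first by rewrite (negbTE lj).
  rewrite cov => /orP[wi|/eqP wi].
    by have := d1 _ _ Dil; rewrite (connect_trans lw (connect1 wi)).
  by have := d1 _ _ Dil; rewrite -wi lw.
rewrite zj mul1r addr0 second_diff_edge_vec Dij => /eqP.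
by rewrite mulf_eq0 oppr_eq0 invr_eq0 (gt_eqF (s1 j)) orbF => /eqP.
Qed.

End Rigidity.

(** * Iterated Lebesgue integrals *)
Local Open Scope classical_set_scope.
Local Open Scope ring_scope.

Lemma pushforward_measure (R : realType) d1 d2 (T1 : measurableType d1)
    (T2 : measurableType d2) (m : {measure set T1 -> \bar R}) (f : T1 -> T2) :
  measurable_fun setT f ->
  exists nu : {measure set T2 -> \bar R}, forall A, nu A = m (f @^-1` A).
Proof.
move=> mf.
by exists (measure_function_pushforward__canonical__measure_function_Measure m mf).
Qed.

Section Lebesgue.
Context {R : realType}.
Local Notation leb := (@lebesgue_measure R).

Lemma lebesgue_measure_translate (a : R) (A : set R) : measurable A ->
  leb (+%R a @^-1` A) = leb A.
Proof.
move=> mA; have ma : measurable_fun setT (fun t : R => a + t) by exact: measurable_funD.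
have [nu nuE] := @pushforward_measure R _ _ _ (measurableTypeR R) leb _ ma.
rewrite -nuE -(@lebesgue_measure_unique _ nu)// => X [[x y] _ <-] /=.
rewrite nuE.
rewrite (_ : _ @^-1` _ = `]x - a, y - a]%classic).
  rewrite lebesgue_measure_itv; apply: etrans (esym (lebesgue_measure_itv `](x - a), (y - a)])).
  rewrite /= !lte_fin ltrD2r; case: ifP => //= _; rewrite -!EFinD.
  by congr EFin; ring.
by apply/seteqP; split => t /=; rewrite !in_itv /= => /andP[h1 h2]; apply/andP; split; lra.
Qed.

Lemma ge0_integral_translate (f : R -> \bar R) (a : R) : measurable_fun setT f ->
  (forall x, (0 <= f x)%E) ->
  (\int[leb]_t f (a + t)%R = \int[leb]_t f t)%E.
Proof.
move=> mf f0; have ma : measurable_fun setT (fun t : R => a + t) by exact: measurable_funD.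
have := @ge0_integral_pushforward _ _ (measurableTypeR R) (measurableTypeR R) R _ ma
  leb setT f measurableT mf (fun x _ => f0 x).
rewrite preimage_setT /comp => <-.
have [nu nuE] := @pushforward_measure R _ _ _ (measurableTypeR R) leb _ ma.
have -> : @pushforward _ _ (measurableTypeR R) (measurableTypeR R) R leb
    (fun t : R => a + t) = nu by apply/funext => A; rewrite nuE.
apply: eq_measure_integral => A mA _.
by apply: etrans (nuE A) _; exact: lebesgue_measure_translate.
Qed.
End Lebesgue.

Section Iterated.
Context {R : realType} {p : nat}.
Local Notation V := (p.-tuple R).
Local Notation leb := (@lebesgue_measure R).
Local Open Scope ereal_scope.
Implicit Types (phi psi : V -> \bar R) (x : V) (l m : 'I_p) (s : seq 'I_p).

Definition upd x l (t : R) : V := [tuple if i == l then t else tnth x i | i < p].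

Lemma tnth_upd x l t i : tnth (upd x l t) i = if i == l then t else tnth x i.
Proof. by rewrite tnth_mktuple. Qed.

Lemma tuple_ext x y : (forall i, tnth x i = tnth y i) -> x = y.
Proof. by move=> e; apply/eq_from_tnth. Qed.

Lemma upd_upd x l t u : upd (upd x l t) l u = upd x l u.
Proof. by apply: tuple_ext => i; rewrite !tnth_upd; case: eqP. Qed.

Lemma upd_comm x l m t u : l != m -> upd (upd x l t) m u = upd (upd x m u) l t.
Proof.
move=> lm; apply: tuple_ext => i; rewrite !tnth_upd.
by case: (eqVneq i l) => [->|//]; rewrite (negbTE lm).
Qed.

Lemma measurable_fun_upd d (T : measurableType d) (g : T -> V) (h : T -> R) l :
  measurable_fun setT g -> measurable_fun setT h ->
  measurable_fun setT (fun z => upd (g z) l (h z)).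
Proof.
move=> mg mh; apply/measurable_fun_tnthP => i /=.
rewrite (_ : _ \o _ = fun z => if i == l then h z else tnth (g z) i).
  case: eqP => _ //.
  by apply: (measurableT_comp (measurable_tnth i)).
by apply/funext => z /=; rewrite tnth_upd.
Qed.

Definition nnmeas phi := measurable_fun setT phi /\ forall x, 0 <= phi x.

(** Overwriting one coordinate keeps the integral a function on the full space, so coordinates can
    be integrated in any order without splitting tuples. *)
Definition lint l phi x : \bar R := \int[leb]_t phi (upd x l t).

Lemma measurable_upd2 x l : measurable_fun setT (upd x l).
Proof. by apply: measurable_fun_upd. Qed.

Lemma nnmeas_lint l phi : nnmeas phi -> nnmeas (lint l phi).
Proof.
move=> [mphi phi0]; split=> [|x]; last by apply: integral_ge0.
apply: (@measurable_fun_fubini_tonelli_F _ _ _ _ _ leb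
  (fun z : V * R => phi (upd z.1 l z.2))) => //.
apply: measurableT_comp => //.
by apply: measurable_fun_upd; [exact: measurable_fst|exact: measurable_snd].
Qed.

Lemma lint_comm l m phi : nnmeas phi -> lint l (lint m phi) = lint m (lint l phi).
Proof.
move=> [mphi phi0]; have [-> //|lm] := eqVneq l m; apply/funext => x; rewrite /lint.
pose T := measurableTypeR R.
pose F (z : T * T) := phi (upd (upd x l z.1) m z.2).
have mF : measurable_fun setT F.
  by apply: measurableT_comp => //; apply: measurable_fun_upd; first apply: measurable_fun_upd.
have := @fubini_tonelli _ _ T T R leb leb F mF (fun=> phi0 _).
rewrite /F /= => ->.
by under eq_integral => t _ do under eq_integral => u _ do rewrite upd_comm//.
Qed.

Lemma lint_shear l (u : V -> R) phi : nnmeas phi -> (forall x t, u (upd x l t) = u x) ->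
  lint l (fun x => phi (upd x l (u x + tnth x l)%R)) = lint l phi.
Proof.
move=> [mphi phi0] uE; apply/funext => x; rewrite /lint.
under eq_integral => t _ do rewrite upd_upd uE tnth_upd eqxx.
rewrite (@ge0_integral_translate _ (fun t => phi (upd x l t)))//.
by apply: measurableT_comp => //; exact: measurable_upd2.
Qed.

Definition lints s phi := foldl (fun psi l => lint l psi) phi s.

Lemma lints_cons l s phi : lints (l :: s) phi = lints s (lint l phi).
Proof. by []. Qed.

Lemma lints_cat s1 s2 phi : lints (s1 ++ s2) phi = lints s2 (lints s1 phi).
Proof. exact: foldl_cat. Qed.

Lemma lints_lint s l phi : nnmeas phi -> lints s (lint l phi) = lint l (lints s phi).
Proof.
elim: s phi => //= m s IH phi h; rewrite -IH; last exact: nnmeas_lint.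
by rewrite lint_comm.
Qed.

Lemma lints_perm s1 s2 phi : nnmeas phi -> perm_eq s1 s2 -> lints s1 phi = lints s2 phi.
Proof.
elim: s1 s2 phi => [|l s1 IH] s2 phi h; first by rewrite perm_sym => /perm_nilP ->.
move=> ps; have : l \in s2 by rewrite -(perm_mem ps) mem_head.
move: ps => /[swap] /path.splitPr [a b] ps.
rewrite lints_cons (IH (a ++ b)); last 2 first.
- exact: nnmeas_lint.
- rewrite -(perm_cons l); apply: (perm_trans ps).
  exact: (permEl (perm_catCA a [:: l] b)).
by rewrite !lints_cat lints_cons lints_lint.
Qed.

Lemma lints_ge0_le s phi psi : nnmeas phi -> nnmeas psi ->
  (forall x, phi x <= psi x) -> forall x, lints s phi x <= lints s psi x.
Proof.
elim: s phi psi => //= l s IH phi psi h1 h2 le; apply: IH; rewrite /=; try exact: nnmeas_lint.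
move=> x; apply: ge0_le_integral => //.
- by move=> t _; exact: h1.2.
- by apply: measurableT_comp; [exact: h1.1|exact: measurable_upd2].
- by apply: measurableT_comp; [exact: h2.1|exact: measurable_upd2].
Qed.

Lemma lints_nneseries s (phi : nat -> V -> \bar R) : (forall n, nnmeas (phi n)) ->
  lints s (fun x => \sum_(n <oo) phi n x) = fun x => \sum_(n <oo) lints s (phi n) x.
Proof.
elim: s phi => //= l s IH phi h.
rewrite -IH => [|n]; last exact: nnmeas_lint.
congr lints; apply/funext => x; rewrite /lint integral_nneseries// => n.
  by apply: measurableT_comp; [exact: (h n).1|exact: measurable_upd2].
by move=> t _; exact: (h n).2.
Qed.

(** The constant [c] is kept general in order to absorb the factors not yet integrated. *)
Lemma lints_prod s (k : 'I_p -> R -> \bar R) (r : 'I_p -> \bar R) (c : \bar R) :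
  uniq s -> 0 <= c ->
  (forall l, measurable_fun setT (k l)) -> (forall l t, 0 <= k l t) ->
  (forall l, \int[leb]_t k l t = r l) ->
  forall x, lints s (fun y => c * \prod_(l <- s) k l (tnth y l)) x =
            c * \prod_(l <- s) r l.
Proof.
move=> us c0 mk k0 kr x; elim: s c c0 us => [|l s IH] c c0 /=.
  by rewrite !big_nil mule1.
move=> /andP[ls us]; rewrite big_cons muleA -IH//; last first.
  by rewrite mule_ge0// -kr integral_ge0.
congr lints; apply/funext => y; rewrite /lint.
transitivity (\int[leb]_t (c * \prod_(j <- s) k j (tnth y j) * k l t)).
  apply: eq_integral => t _; rewrite big_cons tnth_upd eqxx -!muleA; congr (_ * _).
  rewrite muleC; congr (_ * _); apply: eq_big_seq => j js.
  by rewrite tnth_upd; case: eqP => // jl; rewrite -jl js in ls.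
rewrite ge0_integralZl//; [by rewrite kr muleAC|exact: mk|].
by apply: mule_ge0 => //; apply: prode_ge0 => j _; exact: k0.
Qed.

End Iterated.

Section Boxes.
Context {R : realType} {p : nat}.
Local Notation V := (p.-tuple R).

Definition box (B : 'I_p -> set R) : set V := [set y | forall l, B l (tnth y l)].

Lemma measurable_preimage_fun d d' (T1 : measurableType d) (T2 : measurableType d')
  (f : T1 -> T2) (B : set T2) : measurable_fun setT f -> measurable B ->
  measurable (f @^-1` B).
Proof. by move=> mf mB; rewrite -[X in measurable X]setTI; exact: mf. Qed.

Lemma measurable_box B : (forall l, measurable (B l)) -> measurable (box B).
Proof.
move=> mB; rewrite (_ : box B = \bigcap_(l in [set: 'I_p]) (fun y : V => tnth y l) @^-1` B l).
  apply: fin_bigcap_measurable; first exact: finite_finset.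
  by move=> l _; apply: measurable_preimage_fun; [exact: measurable_tnth|exact: mB].
by apply/seteqP; split => y h l; [move=> _|]; exact: h.
Qed.

Definition boxes : set_system V := [set box B | B in [set B | forall l, measurable (B l)]].

Lemma measurable_boxes : @measurable _ V = <<s boxes >>.
Proof.
apply/seteqP; split.
  pose T := g_sigma_algebraType boxes.
  have mid : measurable_fun setT (id : T -> V).
    apply/measurable_fun_tnthP => i _ B mB; rewrite setTI.
    apply: sub_sigma_algebra; exists (fun l => if l == i then B else setT).
      by move=> l; case: ifP.
    apply/seteqP; split => y /=; first by move/(_ i); rewrite eqxx.
    by move=> By l; case: eqP => [->|].
  by move=> A mA; have := mid measurableT A mA; rewrite setTI.
apply: smallest_sub; first exact: sigma_algebra_measurable.
by move=> _ [B mB <-]; exact: measurable_box.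
Qed.

Lemma box_measure_unique (m1 m2 : {measure set V -> \bar R}) :
  (forall B, (forall l, measurable (B l)) -> m1 (box B) = m2 (box B)) ->
  (m1 setT < +oo)%E -> forall A, measurable A -> m1 A = m2 A.
Proof.
move=> m12 m1T; have boxT : box (fun=> setT) = setT by apply/seteqP; split.
apply: (measure_unique boxes (fun=> setT)) => //.
- exact: measurable_boxes.
- move=> _ _ [B mB <-] [C mC <-]; exists (fun l => B l `&` C l).
    by move=> l; exact: measurableI.
  apply/seteqP; split => y /=; first by move=> h; split => l; case: (h l).
  by move=> [h1 h2] l.
- by move=> _; exists (fun=> setT).
- by apply/seteqP; split => // y _; exists 0%N.
- by move=> _ [B mB <-]; exact: m12.
Qed.

End Boxes.

(** * Densities and unit triangular changes of variables *)

Section Density.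
Context {R : realType} {p : nat}.
Local Notation V := (p.-tuple R).
Local Notation leb := (@lebesgue_measure R).
Local Open Scope ereal_scope.
Implicit Types (g h : V -> R) (x y : V).

(** Lebesgue integral over the whole space. Every coordinate of the base point is overwritten, so
    the result depends on it only formally. *)
Definition vol (phi : V -> \bar R) := lints (enum 'I_p) phi.

Definition dens_mass g (A : set V) x := vol (fun y => (\1_A y * g y)%:E) x.

Lemma nnmeas_dens g A : measurable_fun setT g -> (forall y, (0 <= g y)%R) ->
  measurable A -> nnmeas (fun y => (\1_A y * g y)%:E).
Proof.
move=> mg g0 mA; split=> [|y]; last by rewrite lee_fin mulr_ge0.
by apply/measurable_EFinP; apply: measurable_funM.
Qed.

Section Measure.
Variables (g : V -> R) (mg : measurable_fun setT g) (g0 : forall y, (0 <= g y)%R) (x : V).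

Let m A := dens_mass g A x.

Let lints_ge0 s phi : (forall y, 0 <= phi y) -> forall y, 0 <= lints s phi y :> \bar R.
Proof.
by elim: s phi => //= l s IH phi h; apply: IH => y; exact: integral_ge0.
Qed.

Let m0 : m set0 = 0.
Proof.
rewrite /m /dens_mass (_ : (fun y => _) = cst 0); last first.
  by apply/funext => y; rewrite indic0 mul0r.
rewrite /vol; elim: (enum _) => //= l s IH.
by rewrite (_ : lint l _ = cst 0)//; apply/funext => y; rewrite /lint integral0.
Qed.

Let m_ge0 A : 0 <= m A.
Proof. by apply: lints_ge0 => y; rewrite lee_fin mulr_ge0. Qed.

Let m_sigma_additive : semi_sigma_additive m.
Proof.
move=> F mF tF mUF.
have -> : m (\bigcup_n F n) = \sum_(n <oo) m (F n).
  have /(congr1 (fun k => k x)) /= <- := @lints_nneseries _ _ (enum 'I_p)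
    (fun n y => (\1_(F n) y * g y)%:E) (fun n => nnmeas_dens mg g0 (mF n)).
  congr (lints _ _ x); apply/funext => y.
  transitivity ((g y)%:E * \sum_(n <oo) \d_y (F n)).
    have sa : (fun n => \sum_(0 <= i < n) (\d_y (F i) : \bar R)) @ \oo -->
      (\d_y (\bigcup_n F n) : \bar R) by exact: measure_semi_sigma_additive.
    rewrite (cvg_lim _ sa)//.
    by rewrite muleC /dirac -EFinM.
  by rewrite -nneseriesZl//; apply: eq_eseriesr => n _; rewrite /dirac -EFinM mulrC.
by apply: is_cvg_nneseries => n _ _; exact: m_ge0.
Qed.

HB.instance Definition _ := isMeasure.Build _ _ _ m m0 m_ge0 m_sigma_additive.

Lemma dens_mass_measure : exists nu : {measure set V -> \bar R}, forall A, nu A = dens_mass g A x.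
Proof. by exists m. Qed.

End Measure.

Definition has_density (P : set V -> \bar R) g := [/\ measurable_fun setT g,
  forall y, (0 <= g y)%R & forall A x, measurable A -> P A = dens_mass g A x].

(* A triangular shift [x_j |-> x_j - u_j x] is a composition of shears, one
   coordinate at a time. *)
Section Triangular.
Variables (D : rel 'I_p) (u : 'I_p -> V -> R).
Hypotheses (dD : is_dag D) (mu : forall j, measurable_fun setT (u j)).
Hypothesis uD : forall j x y, (forall i, D i j -> tnth x i = tnth y i) -> u j x = u j y.

Definition tshift x : V := [tuple (tnth x j - u j x)%R | j < p].

Lemma tnth_tshift x j : tnth (tshift x) j = (tnth x j - u j x)%R.
Proof. by rewrite tnth_mktuple. Qed.

Lemma measurable_tshift : measurable_fun setT tshift.
Proof.
apply/measurable_fun_tnthP => j; rewrite (_ : _ \o _ = fun x => (tnth x j - u j x)%R).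
  by apply: measurable_funB => //; exact: measurable_tnth.
by apply/funext => x /=; rewrite tnth_tshift.
Qed.

Lemma vol_shear (w : V -> R) j phi : nnmeas phi -> measurable_fun setT w ->
  (forall x t, w (upd x j t) = w x) ->
  vol (fun x => phi (upd x j (w x + tnth x j)%R)) = vol phi.
Proof.
move=> nphi mw wj; have jE : j \in enum 'I_p by rewrite mem_enum.
have nn : nnmeas (fun x => phi (upd x j (w x + tnth x j)%R)).
  split=> [|x]; last exact: nphi.2.
  apply: measurableT_comp; first exact: nphi.1.
  apply: measurable_fun_upd => //; apply: measurable_funD => //; exact: measurable_tnth.
rewrite /vol (lints_perm nn (perm_to_rem jE)) (lints_perm nphi (perm_to_rem jE)).
by rewrite !lints_cons lint_shear.
Qed.

Let pshift (s : seq 'I_p) x : V :=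
  [tuple if j \in s then (tnth x j - u j x)%R else tnth x j | j < p].

Let vol_pshift s phi : nnmeas phi -> uniq s -> pairwise (fun i j => ~~ D j i) s ->
  vol (phi \o pshift s) = vol phi.
Proof.
elim: s phi => [|j s IH] phi nphi.
  move=> _ _; congr vol; apply/funext => x /=; congr phi; apply: tuple_ext => i.
  by rewrite tnth_mktuple.
move=> /andP[js us] /andP[/allP Dj ps].
pose phi' x := phi (upd x j (- u j x + tnth x j)%R).
have uj x t : (- u j (upd x j t))%R = (- u j x)%R.
  congr (- _)%R; apply: uD => i Dij; rewrite tnth_upd; case: eqP => // ij.
  by rewrite ij dag_irr in Dij.
have mnu : measurable_fun setT (fun x => - u j x)%R by exact: measurableT_comp.
have nphi' : nnmeas phi'.
  split=> [|x]; last exact: nphi.2.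
  apply: measurableT_comp; first exact: nphi.1.
  apply: measurable_fun_upd => //; apply: measurable_funD => //; exact: measurable_tnth.
rewrite -(vol_shear nphi mnu uj) -/phi' -(IH phi')//; congr vol; apply/funext => x /=.
rewrite /phi'; congr phi; apply: tuple_ext => i; rewrite tnth_upd !tnth_mktuple inE.
case: eqVneq => [->|//] /=; rewrite (negbTE js) [RHS]addrC; congr (_ - _)%R.
(* The list is in topological order: no parent of [j] is in [s], so [u j] still sees unshifted
   values. *)
apply: uD => k Dkj; rewrite tnth_mktuple; case: ifPn => // ks.
by have := Dj _ ks; rewrite Dkj.
Qed.

Lemma vol_tshift phi : nnmeas phi -> vol (phi \o tshift) = vol phi.
Proof.
move=> nphi; pose s := sort (fun i j => dag_rank D i <= dag_rank D j)%N (enum 'I_p).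
rewrite -[RHS](@vol_pshift s)//.
- congr vol; apply/funext => x /=; congr phi; apply: tuple_ext => i.
  by rewrite !tnth_mktuple mem_sort mem_enum.
- by rewrite sort_uniq enum_uniq.
- apply: (@sub_pairwise _ (fun i j => dag_rank D i <= dag_rank D j)%N).
    move=> i j ij; apply/negP => /(dag_rank_lt dD); by rewrite ltnNge ij.
  rewrite -sorted_pairwise; last by move=> ? ? ?; exact: leq_trans.
  by apply: sort_sorted => i j; exact: leq_total.
Qed.

(** Solves the structural equations by iterating them: after [n] rounds the coordinates of rank
    below [n] are final, whatever the start, and every rank is below [p.+1]. *)
Definition tunshift y : V :=
  iter p.+1 (fun x => [tuple (tnth y j + u j x)%R | j < p]) [tuple 0%R | j < p].

Let iter_stable y n m x x' j : (dag_rank D j < n)%N -> (dag_rank D j < m)%N ->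
  tnth (iter n (fun x => [tuple (tnth y j + u j x)%R | j < p]) x) j =
  tnth (iter m (fun x => [tuple (tnth y j + u j x)%R | j < p]) x') j.
Proof.
elim: n m j => // n IH [//|m] j; rewrite !ltnS => jn jm; rewrite !iterS !tnth_mktuple.
congr (_ + _)%R; apply: uD => i Dij; have := dag_rank_lt dD Dij => ij.
by apply: IH; [exact: leq_trans ij jn|exact: leq_trans ij jm].
Qed.

Let rank_lt j : (dag_rank D j < p.+1)%N.
Proof. by rewrite ltnS -[leqRHS]card_ord max_card. Qed.

Lemma tshiftK : cancel tshift tunshift.
Proof.
move=> x; apply: tuple_ext => j.
rewrite /tunshift (@iter_stable _ _ p.+1 _ x)//; congr (tnth _ j).
elim: p.+1 => // n IH; rewrite iterS IH; apply: tuple_ext => i.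
by rewrite tnth_mktuple tnth_tshift subrK.
Qed.

Lemma measurable_tunshift : measurable_fun setT tunshift.
Proof.
rewrite /tunshift; elim: p.+1 => [|n IH] /=; first exact: measurable_cst.
apply/measurable_fun_tnthP => j.
rewrite (_ : _ \o _ = fun y => (tnth y j + u j (iter n
  (fun x => [tuple (tnth y j + u j x)%R | j < p]) [tuple 0%R | j < p]))%R).
  apply: measurable_funD; first exact: measurable_tnth.
  by apply: measurableT_comp.
by apply/funext => y /=; rewrite tnth_mktuple.
Qed.

(** Each coordinate of the solution is a function of the noises of its ancestors alone; this is what
    makes nondescendants of a vertex independent of its noise. *)
Lemma tunshift_eq y y' j : (forall i, connect D i j -> tnth y i = tnth y' i) ->
  tnth (tunshift y) j = tnth (tunshift y') j.
Proof.
rewrite /tunshift; elim: p.+1 j => [//|n IH] j yy'; rewrite !iterS !tnth_mktuple yy' ?connect0//.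
congr (_ + _)%R; apply: uD => i Dij; apply: IH => k ki; apply: yy'.
exact: connect_trans ki (connect1 Dij).
Qed.

End Triangular.

End Density.

(** * Densities of structural equation models *)
Section StructuralDensity.
Context {R : realType} {p : nat}.
Local Notation V := (p.-tuple R).
Local Notation leb := (@lebesgue_measure R).
Implicit Types (D : rel 'I_p) (mu sigma : 'I_p -> R) (f : 'I_p -> 'I_p -> R -> R).

Lemma C2_derivable (h : R -> R) (x : R) : C2 h -> derivable h x (1 : R).
Proof. by case. Qed.

Lemma C2_continuous (h : R -> R) : C2 h -> continuous h.
Proof.
by move=> ch x; apply: differentiable_continuous; apply/derivable1_diffP; exact: C2_derivable.
Qed.

Lemma C2_measurable (h : R -> R) : C2 h -> measurable_fun setT h.
Proof. by move=> ch; apply: continuous_measurable_fun; exact: C2_continuous. Qed.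

Definition mechanism D mu f (j : 'I_p) (x : V) : R :=
  mu j + \sum_(i | D i j) f j i (tnth x i).

Lemma mechanism_eq D mu f j x y : (forall i, D i j -> tnth x i = tnth y i) ->
  mechanism D mu f j x = mechanism D mu f j y.
Proof. by move=> xy; congr (_ + _); apply: eq_bigr => i /xy ->. Qed.

Lemma residualE D mu f j (x : V) :
  residual D mu f (tnth x) j = tnth x j - mechanism D mu f j x.
Proof. by rewrite /residual /mechanism; ring. Qed.

Lemma measurable_mechanism D mu f j :
  (forall i j, D i j -> measurable_fun setT (f j i)) ->
  measurable_fun setT (mechanism D mu f j).
Proof.
move=> mf; apply: measurable_funD; first exact: measurable_cst.
under eq_fun do rewrite big_mkcond; apply: measurable_sum => i.
case Dij: (D i j); last exact: measurable_cst.
by apply: measurableT_comp; [exact: mf|exact: measurable_tnth].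
Qed.

Definition noise D mu f : V -> V := tshift (mechanism D mu f).

Lemma tnth_noise D mu f x j : tnth (noise D mu f x) j = residual D mu f (tnth x) j.
Proof. by rewrite tnth_tshift residualE. Qed.

Definition gauss_density sigma (y : V) : R := \prod_j normal_pdf 0 (sigma j) (tnth y j).

Lemma measurable_gauss_density sigma : measurable_fun setT (gauss_density sigma).
Proof.
apply: measurable_prod => j _; apply: measurableT_comp; last exact: measurable_tnth.
exact: measurable_normal_pdf.
Qed.

Lemma gauss_density_ge0 sigma y : 0 <= gauss_density sigma y.
Proof. by apply: prodr_ge0 => j _; exact: normal_pdf_ge0. Qed.

Lemma indic_boxE (B : 'I_p -> set R) (y : V) : \1_(box B) y = \prod_j (\1_(B j) (tnth y j) : R).
Proof.
rewrite indicE; case: (boolP (y \in box B)) => [/set_mem yB|/negP yB].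
  by rewrite big1// => j _; rewrite indicE mem_set//; exact: yB.
have [j Bj] : exists j, ~ B j (tnth y j).
  by apply: contra_notP yB => /forallNP h; apply/mem_set => j; apply: contrapT; exact: h.
by rewrite (bigD1 j)//= indicE memNset// mul0r.
Qed.

Lemma gauss_box sigma (B : 'I_p -> set R) x : (forall j, measurable (B j)) ->
  dens_mass (gauss_density sigma) (box B) x = (\prod_j normal_prob 0 (sigma j) (B j))%E.
Proof.
move=> mB; pose k j t := (\1_(B j) t * normal_pdf 0 (sigma j) t)%:E.
rewrite /dens_mass /vol.
rewrite (_ : (fun y => _) = fun y => (1 * \prod_(j <- enum 'I_p) k j (tnth y j))%E).
  rewrite (@lints_prod _ _ (enum 'I_p) k (fun j => normal_prob 0 (sigma j) (B j)))//.
  - by rewrite mul1e big_enum.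
  - by rewrite enum_uniq.
  - move=> l; apply/measurable_EFinP; apply: measurable_funM => //.
    exact: measurable_normal_pdf.
  - by move=> l t; rewrite lee_fin mulr_ge0// normal_pdf_ge0.
  - move=> l; rewrite /normal_prob [RHS]integral_mkcond; apply: eq_integral => t _.
    rewrite patchE /k indicE; case: ifP => _; first by rewrite mul1r.
    by rewrite mul0r.
apply/funext => y; rewrite mul1e big_enum /= prodEFin indic_boxE /gauss_density.
by rewrite -big_split.
Qed.

Section Equivalence.
Variables (D : rel 'I_p) (mu sigma : 'I_p -> R) (f : 'I_p -> 'I_p -> R -> R).
Hypotheses (dD : is_dag D) (mf : forall i j, D i j -> measurable_fun setT (f j i)).

Lemma measurable_noise : measurable_fun setT (noise D mu f).
Proof. by apply: measurable_tshift => j; exact: measurable_mechanism. Qed.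

Lemma nnmeas_gauss A : measurable A ->
  nnmeas (fun y : V => (\1_A y * gauss_density sigma y)%:E).
Proof.
by apply: nnmeas_dens; [exact: measurable_gauss_density|exact: gauss_density_ge0].
Qed.

Lemma vol_noise (phi : V -> \bar R) : nnmeas phi -> vol (phi \o noise D mu f) = vol phi.
Proof.
apply: (vol_tshift dD) => [j|j x y]; first exact: measurable_mechanism.
exact: mechanism_eq.
Qed.

(** Independent Gaussian residuals amount to a density because the residual map preserves volume and
    has a measurable inverse. *)
Lemma noise_law (P : probability V R) :
  (forall B, (forall j, measurable (B j)) ->
     P (noise D mu f @^-1` box B) = (\prod_j normal_prob 0 (sigma j) (B j))%E) <->
  has_density P (gauss_density sigma \o noise D mu f).
Proof.
have mn := measurable_noise.
split=> [law|[_ _ dP] B mB]; last first.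
  rewrite (dP _ [tuple 0 | j < p]); last exact: measurable_preimage_fun (measurable_box mB).
  rewrite -(@gauss_box sigma B [tuple 0 | j < p])// /dens_mass -[in RHS]vol_noise//.
  exact: nnmeas_gauss (measurable_box mB).
split=> [||A x mA].
- by apply: measurableT_comp => //; exact: measurable_gauss_density.
- by move=> y; exact: gauss_density_ge0.
pose g := tunshift (mechanism D mu f).
have mg : measurable_fun setT g by apply: measurable_tunshift => j; exact: measurable_mechanism.
have gK : cancel (noise D mu f) g by apply: (tshiftK dD) => j y y'; exact: mechanism_eq.
have [nu1 nu1E] := pushforward_measure P mn.
have [nu2 nu2E] := dens_mass_measure (measurable_gauss_density sigma) (gauss_density_ge0 sigma) x.
have e : nu1 (g @^-1` A) = nu2 (g @^-1` A).
  apply: box_measure_unique => [B mB||]; last exact: measurable_preimage_fun.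
    by rewrite nu1E nu2E gauss_box//; exact: law.
    by rewrite nu1E preimage_setT; apply: le_lt_trans (probability_le1 P measurableT) (ltry 1).
transitivity (nu1 (g @^-1` A)).
  by rewrite nu1E; congr (P _); apply/seteqP; split=> y /=; rewrite gK.
rewrite e nu2E /dens_mass -vol_noise; last exact: nnmeas_gauss (measurable_preimage_fun mg mA).
congr (vol _ x); apply/funext => y /=; rewrite !indicE.
by rewrite (_ : (_ \in g @^-1` A) = (y \in A))//; apply/idP/idP; rewrite !inE /= gK.
Qed.

End Equivalence.

End StructuralDensity.

Section Sem.
Context {R : realType} {p : nat}.
Local Notation V := (p.-tuple R).
Implicit Types (D : rel 'I_p) (mu sigma : 'I_p -> R) (f : 'I_p -> 'I_p -> R -> R)
  (P : probability V R).

(* A PLSEM in which vanishing edge functions are allowed. *)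
Record weak_sem P D mu f sigma : Prop := WeakSem {
  sem_sigma : forall j, 0 < sigma j;
  sem_C2 : forall i j, D i j -> C2 (f j i);
  sem_integrable : forall i j, D i j ->
    P.-integrable setT (fun x => (f j i (tnth x i))%:E);
  sem_mean : forall i j, D i j -> (\int[P]_x (f j i (tnth x i))%:E = 0)%E;
  sem_density : has_density P (gauss_density sigma \o noise D mu f) }.

Lemma prob_prod_fine (J : finType) (r : J -> \bar R) : (forall j, (r j \is a fin_num)%E) ->
  ((\prod_j fine (r j))%:E = \prod_j r j)%E.
Proof. by move=> fr; rewrite -prodEFin; apply: eq_bigr => j _; rewrite fineK. Qed.

Lemma generated_weak_sem P D : is_dag D -> generated_by_PLSEM P D ->
  exists mu f sigma, weak_sem P D mu f sigma.
Proof.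
move=> dD [mu [f [sigma [dd [T [Q [eps [X [s0 meps indep law [edges Xeq mX PE]]]]]]]]]].
exists mu, f, sigma.
have mf i j : D i j -> measurable_fun setT (f j i).
  by case/edges => ? _ _ _; exact: C2_measurable.
have [nu nuE] := pushforward_measure Q mX.
have intE (h : V -> \bar R) : (\int[P]_x h x = \int[pushforward Q X]_x h x)%E.
  have -> : pushforward Q X = nu by apply/funext => A; rewrite nuE.
  by apply: eq_measure_integral => A mA _; rewrite nuE; exact: PE.
have mfi i j : D i j -> measurable_fun setT (fun x : V => (f j i (tnth x i))%:E).
  move=> Dij; apply/measurable_EFinP; apply: measurableT_comp; first exact: mf.
  exact: measurable_tnth.
have epsE w j : eps j w = tnth (noise D mu f (X w)) j.
  by rewrite tnth_noise /residual {1}Xeq; ring.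
split.
- exact: s0.
- by move=> i j /edges[].
- move=> i j Dij; have [_ _ int _] := edges _ _ Dij.
  apply/integrableP; split; first exact: mfi.
  rewrite intE ge0_integral_pushforward//=; last first.
    apply/measurable_EFinP; apply: (@measurableT_comp _ _ _ _ _ _ (@Num.norm R R)) => //.
    by apply: measurableT_comp; [exact: mf|exact: measurable_tnth].
  by rewrite preimage_setT; have /integrableP[] := int.
- move=> i j Dij; have [_ _ int <-] := edges _ _ Dij.
  rewrite intE integral_pushforward//=.
  exact: (mfi _ _ Dij).
- apply/(noise_law mu sigma dD mf) => B mB.
  rewrite PE; last first.
    by apply: measurable_preimage_fun (measurable_box mB); exact: measurable_noise.
  transitivity (Q (\bigcap_(j in [set: 'I_p]) (eps j @^-1` B j))).
    congr (Q _); apply/seteqP; split => w /=.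
      by move=> h j _ /=; rewrite epsE; exact: h.
    by move=> h j; rewrite -epsE; exact: h.
  rewrite indep// prob_prod_fine => [|j].
    by apply: eq_bigr => j _; rewrite law.
  by rewrite fin_num_measure//; exact: measurable_preimage_fun.
Qed.

Lemma weak_sem_generated P D mu f sigma : is_dag D -> weak_sem P D mu f sigma ->
  (forall i j, D i j -> exists x, f j i x != 0) -> generated_by_PLSEM P D.
Proof.
move=> dD [s0 c2 int mean dens] nz.
have mf i j : D i j -> measurable_fun setT (f j i) by move=> /c2; exact: C2_measurable.
have mn := measurable_noise mu mf.
have law := (noise_law mu sigma dD mf P).2 dens.
(* Canonical realisation: the probability space is the law itself, [X] is the identity and the
   noises are the residuals. *)
exists mu, f, sigma, _, V, P, (fun j x => tnth (noise D mu f x) j), id.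
have boxE (B : 'I_p -> set R) : \bigcap_(j in [set: 'I_p])
    ((fun x => tnth (noise D mu f x) j) @^-1` B j) = noise D mu f @^-1` box B.
  apply/seteqP; split => x /= h j; first exact: h.
  by move=> _; exact: h.
have law1 j B : measurable B ->
    P ((fun x => tnth (noise D mu f x) j) @^-1` B) = normal_prob 0 (sigma j) B.
  move=> mB; pose B' i := if i == j then B else setT.
  have mB' i : measurable (B' i) by rewrite /B'; case: ifP.
  rewrite -[LHS](_ : P (noise D mu f @^-1` box B') = _).
    rewrite law// (bigD1 j)//= /B' eqxx big1 ?mule1// => i /negbTE ->.
    by rewrite probability_setT.
  congr (P _); apply/seteqP; split => x /=; first by move/(_ j); rewrite /B' eqxx.
  by move=> h i; rewrite /B'; case: eqP => [->|].
split => //.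
- move=> j; apply: (measurableT_comp (measurable_tnth j)); exact: mn.
- move=> B mB; rewrite boxE law// prob_prod_fine => [|j].
    by apply: eq_bigr => j _; rewrite law1.
  rewrite fin_num_measure//; apply: measurable_preimage_fun; last exact: mB.
  exact: (measurableT_comp (measurable_tnth j)).
- split => //.
  + by move=> i j Dij; split; [exact: c2|exact: nz|exact: int|exact: mean].
  + by move=> x j; rewrite tnth_noise /residual; ring.
Qed.

End Sem.

(** * Continuous densities of one law agree pointwise *)

Section DensityUniqueness.
Context {R : realType} {p : nat}.
Local Notation V := (p.-tuple R).
Implicit Types (D : rel 'I_p) (mu sigma : 'I_p -> R) (f : 'I_p -> 'I_p -> R -> R)
  (P : probability V R).

(** Sup-norm neighbourhoods, which are boxes, so that their volume is available from the iterated
    integral. *)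
Definition box_nbhs (x : V) : set_system V :=
  filter_from [set d : R | 0 < d] (fun d => box (fun l => ball (tnth x l) d)).

Global Instance box_nbhs_filter x : Filter (box_nbhs x).
Proof.
apply: filter_from_filter; first by exists 1; rewrite /= ltr01.
move=> d e /= d0 e0; exists (Num.min d e); first by rewrite /= lt_min d0.
move=> y h; split=> l; have := h l.
  by apply: le_ball; rewrite ge_min lexx.
by apply: le_ball; rewrite ge_min lexx orbT.
Qed.

Lemma cvg_tnth x l : tnth y l @[y --> box_nbhs x] --> tnth x l.
Proof.
apply/cvg_ballP => e e0; exists e => // y h; exact: h.
Qed.

Lemma cvg_bigsum (I : Type) (s : seq I) (Q : pred I) (F : I -> V -> R) (a : I -> R) x :
  (forall i, Q i -> F i y @[y --> box_nbhs x] --> a i) ->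
  \sum_(i <- s | Q i) F i y @[y --> box_nbhs x] --> \sum_(i <- s | Q i) a i.
Proof.
move=> h; elim: s => [|i s IH].
  by under eq_fun do rewrite big_nil; rewrite big_nil; exact: cvg_cst.
under eq_fun do rewrite big_cons; rewrite big_cons; case: ifP => // Qi.
by apply: cvgD => //; exact: h.
Qed.

Lemma cvg_bigprod (I : Type) (s : seq I) (F : I -> V -> R) (a : I -> R) x :
  (forall i, F i y @[y --> box_nbhs x] --> a i) ->
  \prod_(i <- s) F i y @[y --> box_nbhs x] --> \prod_(i <- s) a i.
Proof.
move=> h; elim: s => [|i s IH].
  by under eq_fun do rewrite big_nil; rewrite big_nil; exact: cvg_cst.
by under eq_fun do rewrite big_cons; rewrite big_cons; apply: cvgM.
Qed.

Lemma vol_cst_box (c : R) (d : R) (x y : V) : 0 <= c -> 0 <= d ->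
  vol (fun z => (\1_(box (fun l => ball (tnth x l) d)) z * c)%:E) y =
  (c * (d *+ 2) ^+ p)%:E.
Proof.
move=> c0 d0; rewrite (_ : (fun z => _) = fun z =>
    (c%:E * \prod_(l <- enum 'I_p) (\1_(ball (tnth x l) d) (tnth z l))%:E)%E); last first.
  by apply/funext => z; rewrite big_enum /= prodEFin indic_boxE mulrC EFinM.
rewrite /vol (@lints_prod _ _ (enum 'I_p) (fun l t => (\1_(ball (tnth x l) d) t)%:E)
  (fun=> (d *+ 2)%:E))//.
- by rewrite big_enum /= prodEFin prodr_const card_ord.
- exact: enum_uniq.
- by move=> l; apply/measurable_EFinP; apply: measurable_indic; exact: measurable_ball.
- move=> l; rewrite integral_indic//; last exact: measurable_ball.
  by rewrite setIT; exact: lebesgue_measure_ball.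
Qed.

Lemma density_unique P g1 g2 x : has_density P g1 -> has_density P g2 ->
  g1 y @[y --> box_nbhs x] --> g1 x -> g2 y @[y --> box_nbhs x] --> g2 x ->
  g1 x = g2 x.
Proof.
wlog le : g1 g2 / g1 x <= g2 x => [H h1 h2 c1 c2|].
  have [h|/ltW h] := leP (g1 x) (g2 x); first exact: H.
  by apply/esym; exact: H.
move=> [m1 p1 d1] [m2 p2 d2] c1 c2; apply/eqP; rewrite eq_le le /= leNgt; apply/negP => lt12.
(* Two levels at one and two thirds of the gap separate the densities on a whole small box, whose
   mass would then be both larger and smaller. *)
pose e := g2 x - g1 x; pose a1 := g1 x + e / 3; pose a2 := g1 x + 2 * e / 3.
have e0 : 0 < e by rewrite subr_gt0.
have [] : box_nbhs x [set y | g1 y < a1 /\ a2 < g2 y].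
  apply: filterI; first by apply: (cvgr_lt _ c1); rewrite /a1; lra.
  by apply: (cvgr_gt _ c2); rewrite /a2 /e; lra.
move=> d /= d0 near_d; pose A := box (fun l => ball (tnth x l) d).
have mA : measurable A by apply: measurable_box => l; exact: measurable_ball.
have a10 : 0 <= a1 by have := p1 x; rewrite /a1; lra.
have a20 : 0 <= a2 by have := p1 x; rewrite /a2; lra.
have : ((a2 * (d *+ 2) ^+ p)%:E <= (a1 * (d *+ 2) ^+ p)%:E)%E.
  rewrite -!(vol_cst_box x x _ (ltW d0))//.
  apply: (@le_trans _ _ (P A)).
    rewrite (d2 A x mA) /dens_mass /vol; apply: lints_ge0_le.
    - by apply: nnmeas_dens => //; exact: measurable_cst.
    - exact: nnmeas_dens.
    - move=> y; rewrite lee_fin indicE; case: (boolP (y \in A)) => [/set_mem yA|_].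
        by rewrite !mul1r ltW//; have [] := near_d y yA.
      by rewrite !mul0r.
  rewrite (d1 A x mA) /dens_mass /vol; apply: lints_ge0_le.
  - exact: nnmeas_dens.
  - by apply: nnmeas_dens => //; exact: measurable_cst.
  - move=> y; rewrite lee_fin indicE; case: (boolP (y \in A)) => [/set_mem yA|_].
      by rewrite !mul1r ltW//; have [] := near_d y yA.
    by rewrite !mul0r.
rewrite lee_fin ler_pM2r; last by rewrite exprn_gt0// mulrn_wgt0.
by rewrite /a1 /a2; lra.
Qed.

Lemma cvg_gauss_noise D mu f sigma x : (forall j, 0 < sigma j) ->
  (forall i j, D i j -> continuous (f j i)) ->
  (gauss_density sigma \o noise D mu f) y @[y --> box_nbhs x] -->
  (gauss_density sigma \o noise D mu f) x.
Proof.
move=> s0 cf; rewrite /comp /gauss_density; apply: cvg_bigprod => j.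
have sj0 : sigma j != 0 by rewrite gt_eqF.
apply: (@continuous_cvg _ _ _ _ _ (fun y => tnth (noise D mu f y) j) (normal_pdf 0 (sigma j))).
  exact: continuous_normal_pdf.
under eq_fun do rewrite tnth_noise; rewrite tnth_noise /residual.
apply: cvgB; first by apply: cvgB; [exact: cvg_tnth|exact: cvg_cst].
apply: cvg_bigsum => i Dij.
by apply: (@continuous_cvg _ _ _ _ _ (fun y => tnth y i) (f j i)); [exact: cf|exact: cvg_tnth].
Qed.

Lemma gauss_densityE sigma (y : V) : (forall j, 0 < sigma j) -> gauss_density sigma y =
  (\prod_j normal_peak (sigma j)) * expR (- (\sum_j (tnth y j / sigma j) ^+ 2) / 2).
Proof.
move=> s0; rewrite -sumrN mulr_suml expR_sum -big_split; apply: eq_bigr => j _ /=.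
have sj0 : sigma j != 0 by rewrite gt_eqF.
by rewrite normal_pdfE// /normal_fun subr0; congr (_ * expR _); field.
Qed.

Lemma weak_sem_potential P D1 D2 mu1 mu2 f1 f2 sigma1 sigma2 :
  weak_sem P D1 mu1 f1 sigma1 -> weak_sem P D2 mu2 f2 sigma2 ->
  exists k, forall x : 'I_p -> R,
    \sum_l (residual D1 mu1 f1 x l / sigma1 l) ^+ 2 =
    \sum_l (residual D2 mu2 f2 x l / sigma2 l) ^+ 2 + k.
Proof.
move=> [s1 c1 _ _ d1] [s2 c2 _ _ d2].
pose K (sigma : 'I_p -> R) := \prod_j normal_peak (sigma j).
have K0 sigma : (forall j, 0 < sigma j) -> 0 < K sigma.
  by move=> s0; apply: prodr_gt0 => j _; rewrite normal_peak_gt0// gt_eqF.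
(* [k] comes from the normalising constants when logarithms of the two densities are equated. *)
exists (2 * (ln (K sigma1) - ln (K sigma2))) => x.
pose t : V := [tuple x i | i < p].
have := density_unique d1 d2
  (@cvg_gauss_noise D1 mu1 f1 sigma1 t s1 (fun i j Dij => C2_continuous (c1 i j Dij)))
  (@cvg_gauss_noise D2 mu2 f2 sigma2 t s2 (fun i j Dij => C2_continuous (c2 i j Dij))).
have tx : tnth t = x by apply/funext => i; rewrite tnth_mktuple.
rewrite /= !gauss_densityE// => /(congr1 (@ln R)).
rewrite !lnM ?posrE ?expR_gt0 ?K0// !expRK.
have nE D mu f sigma : \sum_j (tnth (noise D mu f t) j / sigma j) ^+ 2 =
    \sum_j (residual D mu f x j / sigma j) ^+ 2.
  by apply: eq_bigr => j _; rewrite tnth_noise tx.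
by rewrite !nE -/(K sigma1) -/(K sigma2); lra.
Qed.

End DensityUniqueness.

(** * Conditional probabilities and the local Markov property *)
Section Transfer.
Context {R : realType} d1 d2 (T1 : measurableType d1) (T2 : measurableType d2).

Lemma probability_pushforward (P : probability T1 R) (g : T1 -> T2) :
  measurable_fun setT g ->
  exists nu : probability T2 R, forall A, nu A = P (g @^-1` A).
Proof.
move=> mg; pose g' : {mfun T1 >-> T2} := HB.pack g (isMeasurableFun.Build _ _ _ _ g mg).
by exists (distribution P g').
Qed.

Section FinitePushforward.
Variables (m : {finite_measure set T1 -> \bar R}) (g : {mfun T1 >-> T2}).

Definition fpush : set T2 -> \bar R := pushforward m g.

Let fpush0 : fpush set0 = 0%E. Proof. exact: measure0. Qed.

Let fpush_ge0 A : (0 <= fpush A)%E. Proof. exact: measure_ge0. Qed.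

Let fpush_sigma_additive : semi_sigma_additive fpush.
Proof. exact: measure_semi_sigma_additive. Qed.

HB.instance Definition _ := isMeasure.Build _ _ _ fpush fpush0 fpush_ge0 fpush_sigma_additive.

Let fpush_fin : fin_num_fun fpush.
Proof.
by move=> A mA; apply: fin_num_measure; exact: measurable_preimage_fun.
Qed.

HB.instance Definition _ := Measure_isFinite.Build _ _ _ fpush fpush_fin.

End FinitePushforward.

Lemma finite_pushforward (m : {finite_measure set T1 -> \bar R}) (g : T1 -> T2) :
  measurable_fun setT g ->
  exists nu : {finite_measure set T2 -> \bar R}, forall A, nu A = m (g @^-1` A).
Proof.
move=> mg; pose g' : {mfun T1 >-> T2} := HB.pack g (isMeasurableFun.Build _ _ _ _ g mg).
by exists (fpush m g').
Qed.

Lemma ge0_integral_transfer (m : {measure set T1 -> \bar R})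
    (nu : {measure set T2 -> \bar R}) (g : T1 -> T2) (E : set T2) (h : T2 -> \bar R) :
  measurable_fun setT g -> (forall A, nu A = m (g @^-1` A)) ->
  measurable E -> measurable_fun setT h -> (forall y, 0 <= h y)%E ->
  (\int[nu]_(y in E) h y = \int[m]_(x in g @^-1` E) h (g x))%E.
Proof.
move=> mg nuE mE mh h0.
have <- : pushforward m g = nu by apply/funext => A; rewrite nuE.
by rewrite ge0_integral_pushforward//; exact: measurable_funTS.
Qed.

End Transfer.

Lemma ge0_integral_mrestr (R : realType) d (T : measurableType d)
    (m : {measure set T -> \bar R}) (D E : set T) (mD : measurable D) (h : T -> \bar R) :
  measurable E -> measurable_fun setT h -> (forall y, 0 <= h y)%E ->
  (\int[mrestr m mD]_(x in E) h x = \int[m]_(x in E `&` D) h x)%E.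
Proof.
move=> mE mh h0; have mED : measurable (E `&` D) by exact: measurableI.
have mEnD : measurable (E `\` D) by exact: measurableD.
rewrite -{1}(setUIDK E D) ge0_integral_setU//; last 2 first.
- exact: measurable_funTS.
- by apply/disj_setPS => x [[_ xD] [_ nxD]].
rewrite [X in (_ + X)%E]null_set_integral//; last 2 first.
- exact: measurable_funTS.
- by apply: etrans (measure0 m); rewrite /= /mrestr setDKI.
rewrite adde0; apply: eq_measure_integral => A mA AED.
by rewrite /= /mrestr setIidl// => x /AED [].
Qed.

Section ConditionalVersion.
Context {R : realType} {p : nat}.
Local Notation V := (p.-tuple R).
Implicit Types (C : {set 'I_p}) (P : probability V R).

(** Encodes measurability in the coordinates [C] by a retraction: a function depends only on [C]
    when [keep C] leaves it unchanged. Conditioning then becomes differentiation of measures pushed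
    forward by [keep C]. *)
Definition keep C (x : V) : V := [tuple if i \in C then tnth x i else 0 | i < p].

Lemma tnth_keep C x i : tnth (keep C x) i = if i \in C then tnth x i else 0.
Proof. by rewrite tnth_mktuple. Qed.

Lemma measurable_keep C : measurable_fun setT (keep C).
Proof.
apply/measurable_fun_tnthP => i.
rewrite (_ : _ \o _ = fun x => if i \in C then tnth x i else 0).
  by case: (i \in C); [exact: measurable_tnth|exact: measurable_cst].
by apply/funext => x /=; rewrite tnth_keep.
Qed.

Lemma depends_only_on_keep C (Y : Type) (h : V -> Y) x :
  depends_only_on C h -> h (keep C x) = h x.
Proof. by move=> dh; apply: dh => i iC; rewrite tnth_keep iC. Qed.

Lemma depends_only_on_comp_keep C (Y : Type) (h : V -> Y) :
  depends_only_on C (h \o keep C).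
Proof.
move=> x y xy /=; congr h; apply: tuple_ext => i; rewrite !tnth_keep.
by case: ifP => // /xy.
Qed.

Lemma preimage_keep C (F : set V) : depends_only_on C F -> keep C @^-1` F = F.
Proof. by move=> dF; apply/funext => x /=; exact: depends_only_on_keep. Qed.

(** The version is the Radon-Nikodym derivative of P(E ∩ .) on the [C]-events. The second clause,
    taking a [C]-measurable factor out, serves to multiply it with the kernel of a vertex. *)
Lemma exists_cond_prob_version P C E : measurable E ->
  exists h, cond_prob_version P C E h /\
    forall (phi : V -> R) F, measurable_fun setT phi -> depends_only_on C phi ->
      (forall x, 0 <= phi x) -> S_event C F ->
      (\int[P]_(x in F `&` E) (phi x)%:E = \int[P]_(x in F) (phi x * h x)%:E)%E.
Proof.
move=> mE; have mk := measurable_keep C.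
have [m1 m1E] := probability_pushforward P mk.
have [nu nuE] := finite_pushforward (mrestr P mE) mk.
have nule A : measurable A -> (nu A <= m1 A)%E.
  move=> mA; rewrite nuE m1E /mrestr; have := measurable_preimage_fun mk mA => mkA.
  by apply: le_measure; rewrite ?inE//; exact: measurableI.
have numu : nu `<< m1.
  apply/null_content_dominatesP => A mA m10; apply/eqP.
  by rewrite eq_le measure_ge0 andbT -m10 nule.
pose g := Radon_Nikodym_SigmaFinite.f nu m1.
have g0 y : (0 <= g y)%E by exact: Radon_Nikodym_SigmaFinite.f_ge0.
have ig : m1.-integrable setT g by exact: Radon_Nikodym_SigmaFinite.f_integrable.
have mg : measurable_fun setT g by exact: measurable_int ig.
pose S := [set y | (1 < g y)%E].
have mS : measurable S by rewrite -[S]setTI; exact: emeasurable_fun_o_infty.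
(* Where [g] exceeds 1, its integral is squeezed between the two measures, so it equals 1 almost
   everywhere there. This justifies the cut at 1, needed because versions must lie in [0, 1] at
   every point. *)
have gS : ae_eq m1 S g (cst 1%E).
  apply: integral_ae_eq => //; first exact: integrableS ig.
  move=> A AS mA; apply/eqP; rewrite eq_le; apply/andP; split.
    rewrite -Radon_Nikodym_SigmaFinite.f_integral// integral_cst// mul1e.
    exact: nule.
  apply: ge0_le_integral => //; first exact: measurable_funTS.
  by move=> y /AS /ltW.
pose gm y := Order.min (g y) 1%E.
have mgm : measurable_fun setT gm by apply: measurable_mine.
have gm0 y : (0 <= gm y)%E by rewrite le_min g0 lee01.
have gm1 y : (gm y <= 1)%E by rewrite ge_min lexx orbT.
have gmfin y : gm y \is a fin_num.
  by rewrite ge0_fin_numE// (le_lt_trans (gm1 y))// ltry.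
have ggm : ae_eq m1 setT g gm.
  apply: filterS gS => y gSy _; rewrite /gm.
  case: (ltP 1%E (g y)) => gy; first by rewrite gSy// minxx.
  by [].
pose h x := fine (gm (keep C x)).
have hE x : (h x)%:E = gm (keep C x) by rewrite /h fineK.
have mh : measurable_fun setT h.
  by apply: measurableT_comp => //; apply: (measurableT_comp mgm).
have key (phi : V -> R) F : measurable_fun setT phi -> depends_only_on C phi ->
      (forall x, 0 <= phi x) -> S_event C F ->
      (\int[P]_(x in F `&` E) (phi x)%:E = \int[P]_(x in F) (phi x * h x)%:E)%E.
  move=> mphi dphi phi0 [mF dF].
  have mephi : measurable_fun setT (fun x => (phi x)%:E) by exact/measurable_EFinP.
  have phie0 x : (0 <= (phi x)%:E)%E by rewrite lee_fin.
  transitivity (\int[nu]_(y in F) (phi y)%:E)%E.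
    rewrite (ge0_integral_transfer mk nuE)// preimage_keep//.
    rewrite ge0_integral_mrestr//.
      by apply: eq_integral => x _; rewrite (depends_only_on_keep x dphi).
    by apply: measurableT_comp => //; exact: measurableT_comp mk.
  rewrite -(Radon_Nikodym_SigmaFinite.change_of_variables numu)//; last exact: measurable_funTS.
  transitivity (\int[m1]_(y in F) ((phi y)%:E * gm y))%E.
    apply: ge0_ae_eq_integral => //.
    - by apply: measurable_funTS; apply: emeasurable_funM.
    - by apply: measurable_funTS; apply: emeasurable_funM.
    - by move=> y _; rewrite mule_ge0.
    - by move=> y _; rewrite mule_ge0.
    - by apply: filterS ggm => y /(_ I) gy _; rewrite -gy.
  rewrite (ge0_integral_transfer mk m1E)//; last 2 first.
  - exact: emeasurable_funM.
  - by move=> y; rewrite mule_ge0.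
  rewrite preimage_keep//; apply: eq_integral => x _.
  by rewrite (depends_only_on_keep x dphi) EFinM hE.
exists h; split => //; split => //.
- exact: (@depends_only_on_comp_keep C _ (fine \o gm)).
- by move=> x; rewrite -!lee_fin hE gm0 gm1.
- move=> F SF; have := key (cst 1) F (measurable_cst _) (fun _ _ _ => erefl) (fun=> ler01) SF.
  rewrite (eq_integral (cst 1%E))// integral_cst ?mul1e; last exact: measurableI SF.1 mE.
  by rewrite setIC => ->; apply: eq_integral => x _; rewrite mul1r.
Qed.

End ConditionalVersion.

Section LocalMarkov.
Context {R : realType} {p : nat}.
Local Notation V := (p.-tuple R).
Variables (P : probability V R) (D : rel 'I_p) (mu sigma : 'I_p -> R)
  (f : 'I_p -> 'I_p -> R -> R).
Hypotheses (dD : is_dag D) (ws : weak_sem P D mu f sigma).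

Let mf i j : D i j -> measurable_fun setT (f j i).
Proof. by move=> /(sem_C2 ws); exact: C2_measurable. Qed.

Let mn : measurable_fun setT (noise D mu f). Proof. exact: measurable_noise. Qed.

Let law B : (forall j, measurable (B j)) ->
  P (noise D mu f @^-1` box B) = (\prod_j normal_prob 0 (sigma j) (B j))%E.
Proof. by apply: (noise_law mu sigma dD mf P).2; exact: sem_density ws. Qed.

Let N l : probability (measurableTypeR R) R := normal_prob 0 (sigma l).

(** Setting coordinate [l] to 0 turns both sides into finite measures of [E], and these are compared
    on boxes. *)
Lemma noise_indep l (E : set V) (B : set R) : measurable E -> measurable B ->
  (forall y t, E (upd y l t) = E y) ->
  (P (noise D mu f @^-1` (E `&` [set y | B (tnth y l)])) =
   P (noise D mu f @^-1` E) * N l B)%E.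
Proof.
move=> mE mB El.
have [G GE] := probability_pushforward P mn.
have mBl : measurable [set y : V | B (tnth y l)].
  exact: (measurable_preimage_fun (measurable_tnth l) mB).
have mz : measurable_fun setT (fun y : V => upd y l 0).
  by apply: measurable_fun_upd.
have [ma maE] := pushforward_measure (mrestr G mBl) mz.
have [mb0 mb0E] := pushforward_measure G mz.
have NB : N l B = (fine (N l B))%:E by rewrite fineK// fin_num_measure.
have NB0 : 0 <= fine (N l B) by rewrite fine_ge0// measure_ge0.
pose mb : {measure set V -> \bar R} := mscale (NngNum NB0) mb0.
have mbE A : mb A = (N l B * mb0 A)%E by rewrite NB.
have zE : (fun y : V => upd y l 0) @^-1` E = E.
  by apply/funext => y /=; rewrite El.
rewrite -!GE muleC.
transitivity (ma E); first by rewrite maE /mrestr zE.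
rewrite -[in RHS]zE -mb0E -mbE.
apply: box_measure_unique => // [B' mB'|]; last first.
  rewrite maE; apply: le_lt_trans (ltry 1); apply: probability_le1.
  by apply: measurableI => //; exact: (measurable_preimage_fun mz).
pose BT (S : set R) j := if j == l then S else B' j.
have mBT S : measurable S -> forall j, measurable (BT S j).
  by move=> mS j; rewrite /BT; case: eqP.
have GBT S : measurable S -> G (box (BT S)) =
    (N l S * \prod_(j | j != l) normal_prob 0 (sigma j) (B' j))%E.
  move=> mS; rewrite GE law; last exact: mBT.
  rewrite (bigD1 l)//= /BT eqxx; congr (_ * _)%E.
  by apply: eq_bigr => j /negbTE ->.
have -> : ma (box B') = G ((fun y : V => upd y l 0) @^-1` box B' `&`
    [set y | B (tnth y l)]) by rewrite maE.
rewrite mbE mb0E.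
(* The [l]-side of a box now only matters through 0: either it contains 0 and imposes nothing, or
   the preimage is empty. *)
have [Bl0|nBl0] := pselect (B' l 0).
  have e S : (fun y : V => upd y l 0) @^-1` box B' `&` [set y | S (tnth y l)] = box (BT S).
    apply/seteqP; split => y /=.
      move=> [h Sy] j; rewrite /BT; case: eqP => [->//|/eqP jl].
      by have := h j; rewrite tnth_upd (negbTE jl).
    move=> h; split; last by have := h l; rewrite /BT eqxx.
    move=> j; rewrite tnth_upd; case: eqP => [->//|/eqP jl].
    by have := h j; rewrite /BT (negbTE jl).
  rewrite e GBT//.
  have -> : (fun y : V => upd y l 0) @^-1` box B' = box (BT setT).
    by rewrite -e; apply/seteqP; split => // y [].
  congr (_ * _)%E; apply/esym; apply: etrans (GBT _ measurableT) _.
  by rewrite probability_setT mul1e.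
have -> : (fun y : V => upd y l 0) @^-1` box B' = set0.
  apply/seteqP; split => // y /(_ l); rewrite tnth_upd eqxx.
  exact: nBl0.
by rewrite set0I !measure0 mule0.
Qed.

Definition nondesc l : {set 'I_p} := [set j | ~~ connect D l j]%SET.

(* the conditional probability of an event about [X_l] given the parents of [l] *)
Definition kernel_prob l (E : set V) (x : V) : R :=
  fine (N l [set e | E (upd x l (mechanism D mu f l x + e))]).

Let shifted l (E : set V) : set (V * measurableTypeR R) :=
  [set z | E (upd z.1 l (mechanism D mu f l z.1 + z.2))].

Let mm l : measurable_fun setT (mechanism D mu f l).
Proof. exact: measurable_mechanism. Qed.

Let mshifted l E : measurable E -> measurable (shifted l E).
Proof.
move=> mE; apply: (@measurable_preimage_fun _ _ _ _
  (fun z : V * measurableTypeR R => upd z.1 l (mechanism D mu f l z.1 + z.2))) => //.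
apply: measurable_fun_upd; first exact: measurable_fst.
apply: measurable_funD; last exact: measurable_snd.
by apply: measurableT_comp; [exact: mm|exact: measurable_fst].
Qed.

Let kernel_probE l E x : measurable E ->
  (kernel_prob l E x)%:E = N l (xsection (shifted l E) x).
Proof.
move=> mE; rewrite /kernel_prob.
have -> : [set e | E (upd x l (mechanism D mu f l x + e))] = xsection (shifted l E) x.
  by apply/seteqP; split => e /=; rewrite /xsection /= inE.
by rewrite fineK// fin_num_measure//; apply: measurable_xsection; exact: mshifted.
Qed.

Lemma measurable_kernel_prob l E : measurable E -> measurable_fun setT (kernel_prob l E).
Proof.
move=> mE; apply/measurable_EFinP.
rewrite (_ : _ \o _ = (N l : set _ -> _) \o xsection (shifted l E)).
  by apply: measurable_fun_xsection; exact: mshifted.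
by apply/funext => x /=; exact: kernel_probE.
Qed.

Lemma kernel_prob_itv l E x : measurable E -> 0 <= kernel_prob l E x <= 1.
Proof.
move=> mE; rewrite -!lee_fin kernel_probE// measure_ge0 probability_le1//.
by apply: measurable_xsection; exact: mshifted.
Qed.

(** [X_l] is its mechanism plus its own noise. The nondescendants, which include the parents, are
    functions of the other noises, so the pair (nondescendants, noise of [l]) has a product law and
    Fubini applies. *)
Lemma kernel_prob_int l (EA H : set V) : S_event [set l]%SET EA ->
  S_event (nondesc l) H ->
  (P (EA `&` H) = \int[P]_(x in H) (kernel_prob l EA x)%:E)%E.
Proof.
move=> [mEA dEA] [mH dH].
pose r : V -> V := keep (nondesc l); have mr : measurable_fun setT r by exact: measurable_keep.
pose e (x : V) : measurableTypeR R := tnth (noise D mu f x) l.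
have me : measurable_fun setT e by apply: (measurableT_comp (measurable_tnth l)).
have mW : measurable_fun setT (fun x => (r x, e x)) by exact: measurable_fun_pair.
have [m1 m1E] := probability_pushforward P mr.
have [m' m'E] := pushforward_measure P mW.
have pl i : D i l -> i \in nondesc l.
  by move=> Dil; rewrite inE; exact: dD.
have mech_r x : mechanism D mu f l (r x) = mechanism D mu f l x.
  by apply: mechanism_eq => i /pl il; rewrite tnth_keep il.
have EA_r x t : EA (upd (r x) l t) = EA (upd x l t).
  by apply: dEA => i /set1P ->; rewrite !tnth_upd eqxx.
have H_r x : H (r x) = H x by exact: depends_only_on_keep.
pose g := tunshift (mechanism D mu f).
have mg : measurable_fun setT g by apply: measurable_tunshift => j; exact: mm.
have gK : cancel (noise D mu f) g by apply: (tshiftK dD) => j y y'; exact: mechanism_eq.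
have prodE (A : set V) (B : set (measurableTypeR R)) : measurable A -> measurable B ->
    m' (A `*` B) = (m1 A * N l B)%E.
  move=> mA mB; rewrite m'E m1E.
  have mrg : measurable ((r \o g) @^-1` A).
    by apply: measurable_preimage_fun => //; exact: measurableT_comp.
  have inv y t : ((r \o g) @^-1` A) (upd y l t) = ((r \o g) @^-1` A) y.
    rewrite /=; congr (A _); apply: tuple_ext => i; rewrite !tnth_keep.
    case: ifPn => //; rewrite inE => nli.
    apply: (tunshift_eq (D := D)) => [j y1 y2|j ji]; first exact: mechanism_eq.
    by rewrite tnth_upd; case: eqP => // jl; rewrite jl in ji; rewrite ji in nli.
  have := noise_indep mrg mB inv.
  have -> : noise D mu f @^-1` ((r \o g) @^-1` A) = r @^-1` A.
    by apply/seteqP; split => x /=; rewrite gK.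
  move=> <-; congr (P _); apply/seteqP; split => x /=; by rewrite /= gK.
pose X : set (V * measurableTypeR R) := shifted l EA `&` (fst @^-1` H).
have mX : measurable X.
  apply: measurableI; first exact: mshifted.
  by apply: measurable_preimage_fun => //; exact: measurable_fst.
transitivity (m' X).
  rewrite m'E; congr (P _); apply/funext => x.
  rewrite /X /shifted /setI /preimage /mkset /= EA_r mech_r H_r /e tnth_noise residualE.
  rewrite addrC subrK (_ : upd x l (tnth x l) = x)//; apply: tuple_ext => i.
  by rewrite tnth_upd; case: eqP => // ->.
rewrite -(product_measure_unique prodE mX) /product_measure1.
rewrite (ge0_integral_transfer mr m1E)//; last first.
  exact: measurable_fun_xsection.
rewrite preimage_setT [RHS]integral_mkcond; apply: eq_integral => x _ /=.
rewrite patchE; case: ifPn => [/set_mem Hx|/negP nHx].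
  rewrite kernel_probE//; congr (N l _).
  apply/seteqP; split => t; rewrite /xsection /mkset !in_setE /X /shifted /setI /mkset /=
    EA_r mech_r H_r; first by case.
  by [].
rewrite (_ : xsection _ _ = set0) ?measure0//.
apply/seteqP; split => // t; rewrite /xsection /mkset in_setE /X /setI /mkset /= H_r => -[_ Hx].
by apply: nHx; exact/mem_set.
Qed.

(** Without the edge function of [k], the kernel of [l] depends only on the remaining parents, yet
    it still gives the conditional probability on all nondescendant events, [k] included. *)
Lemma vanishing_edge_cond_indep k l : D k l -> (forall x, f l k x = 0) ->
  cond_indep P [set l]%SET [set k]%SET ([set i | D i l] :\ k)%SET.
Proof.
move=> Dkl f0; set C := (_ :\ k)%SET => EA EB SA SB.
have nd i : D i l -> i \in nondesc l by move=> Dil; rewrite inE; exact: dD.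
have mech_C x y : (forall i, i \in C -> tnth x i = tnth y i) ->
    mechanism D mu f l x = mechanism D mu f l y.
  move=> xy; congr (_ + _); apply: eq_bigr => i Dil.
  have [->|ik] := eqVneq i k; first by rewrite !f0.
  by rewrite xy// !inE ik Dil.
have subC (Y : Type) (F : V -> Y) : depends_only_on C F -> depends_only_on (nondesc l) F.
  move=> dF x y xy; apply: dF => i; rewrite !inE => /andP[_ /nd]; exact: xy.
have subk (Y : Type) (F : V -> Y) : depends_only_on [set k]%SET F -> depends_only_on (nondesc l) F.
  by move=> dF x y xy; apply: dF => i /set1P ->; apply: xy; exact: nd.
have dA : depends_only_on C (kernel_prob l EA).
  move=> x y xy; rewrite /kernel_prob (mech_C _ _ xy); congr (fine (N l _)).
  apply/funext => e; apply: SA.2 => i /set1P ->; by rewrite !tnth_upd eqxx.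
have mA := measurable_kernel_prob l SA.1.
have A01 x := kernel_prob_itv l x SA.1.
have [hB [cB intB]] := exists_cond_prob_version P C SB.1.
have [mB dB B01 _] := cB.
exists (kernel_prob l EA), hB, (fun x => kernel_prob l EA x * hB x); split => //.
- split => // F [mF dF]; apply: kernel_prob_int => //; split => //; exact: subC.
- split.
  + exact: measurable_funM.
  + by move=> x y xy; rewrite (dA _ _ xy) (dB _ _ xy).
  + move=> x; have /andP[a0 a1] := A01 x; have /andP[b0 b1] := B01 x.
    by rewrite mulr_ge0// mulr_ile1.
  (* The kernel formula is applied to the nondescendant event [F] cut with [EB]; the kernel is then
     taken out as a [C]-measurable factor. *)
  + move=> F SF; rewrite -setIA (setIC EB) (@kernel_prob_int l)//.
      by apply: intB => // x; have /andP[] := A01 x.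
    split; first exact: measurableI SF.1 SB.1.
    by move=> x y xy; rewrite /setI /=; congr (_ /\ _);
      [apply: (subC _ _ SF.2)|apply: (subk _ _ SB.2)].
- exact: aeW.
Qed.

Lemma faithful_edge_nonzero k l : faithful P D -> D k l -> exists x, f l k x != 0.
Proof.
move=> fa Dkl; apply: contrapT => /forallNP nz.
have f0 x : f l k x = 0 by have /negP := nz x; rewrite negbK => /eqP.
have lk : l != k by apply: contraTneq Dkl => ->; rewrite dag_irr.
have skl : skel D l k by rewrite /skel Dkl orbT.
apply: (adjacent_not_dsep lk skl) (_ : dsep D _ _ ([set i | D i l] :\ k)%SET).
apply/fa; last exact: vanishing_edge_cond_indep.
- by rewrite disjoints1 inE.
- by rewrite disjoints1 !inE dag_irr// andbF.
- by rewrite disjoints1 !inE eqxx.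
Qed.

End LocalMarkov.

(** * Reversing a covered affine edge *)
Section C2Closure.
Context {R : realType}.
Implicit Types g h : R -> R.

Lemma derivable_lin g h (a x : R) : derivable g x 1 -> derivable h x 1 ->
  derivable (fun u => g u + a * h u) x (1 : R).
Proof.
move=> dg dh; apply: derivableD; first exact: dg.
by apply: derivableM; [exact: derivable_cst|exact: dh].
Qed.

Lemma derive1_lin g h (a : R) : (forall x, derivable g x 1) -> (forall x, derivable h x 1) ->
  derive1 (fun u => g u + a * h u) = fun u => derive1 g u + a * derive1 h u.
Proof.
move=> dg dh; apply/funext => u; rewrite !derive1E.
have d1 : is_derive u (1 : R) g ('D_1 g u) by exact: derivableP.
have d2 : is_derive u (1 : R) h ('D_1 h u) by exact: derivableP.
have d3 : is_derive u (1 : R) (fun u => g u + a * h u) ('D_1 g u + a * 'D_1 h u).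
  exact: is_derive_eq.
exact: (@derive_val _ _ _ _ _ _ _ d3).
Qed.

Lemma C2_lin g h (a : R) : C2 g -> C2 h -> C2 (fun u => g u + a * h u).
Proof.
move=> [g1 g2 g3] [h1 h2 h3]; split.
- by move=> x; exact: derivable_lin.
- by move=> x; rewrite (derive1_lin a g1 h1); exact: derivable_lin.
- rewrite (derive1_lin a g1 h1) (derive1_lin a g2 h2) => x.
  have G : derive1 (derive1 g) u @[u --> x] --> derive1 (derive1 g) x by exact: g3.
  have H : derive1 (derive1 h) u @[u --> x] --> derive1 (derive1 h) x by exact: h3.
  exact: (cvgD G (cvgM (cvg_cst a) H)).
Qed.

Lemma derive1_constant (c : R) : derive1 (fun=> c : R) = fun=> 0.
Proof. by apply/funext => u; rewrite derive1E derive_cst. Qed.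

Lemma C2_cst (c : R) : C2 (fun=> c).
Proof.
split.
- by move=> x; exact: derivable_cst.
- by rewrite derive1_constant => x; exact: derivable_cst.
- by rewrite !derive1_constant => x; exact: cvg_cst.
Qed.

Lemma C2_id : C2 (fun u : R => u).
Proof.
have d1 : derive1 (fun u : R => u) = fun=> 1.
  by apply/funext => u; rewrite derive1E derive_id.
split.
- by move=> x; exact: derivable_id.
- by rewrite d1 => x; exact: derivable_cst.
- by rewrite d1 derive1_constant => x; exact: cvg_cst.
Qed.

End C2Closure.

(** * First absolute moment of a normal law *)

Section NormalMoment.
Context {R : realType}.
Local Notation leb := (@lebesgue_measure R).

Lemma ge0_integral_normal_prob (sigma : R) (nu : {finite_measure set (measurableTypeR R) -> \bar R})
    (h : R -> \bar R) :
  (forall A, measurable A -> nu A = normal_prob 0 sigma A) ->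
  measurable_fun setT h -> (forall t, 0 <= h t)%E ->
  (\int[nu]_t h t = \int[leb]_t (h t * (normal_pdf 0 sigma t)%:E))%E.
Proof.
move=> nuE mh h0.
have numu : nu `<< leb.
  apply/null_content_dominatesP => A mA A0; rewrite nuE//.
  by have /null_content_dominatesP := normal_prob_dominates 0 sigma; exact.
have mpdf : measurable_fun setT (fun t => (normal_pdf 0 sigma t)%:E).
  by apply/measurable_EFinP; exact: measurable_normal_pdf.
rewrite -(Radon_Nikodym_SigmaFinite.change_of_variables numu h0 measurableT mh).
have ig := Radon_Nikodym_SigmaFinite.f_integrable numu.
have mg := measurable_int _ ig.
have e : ae_eq leb setT (Radon_Nikodym_SigmaFinite.f nu leb) (fun t => (normal_pdf 0 sigma t)%:E).
  apply: integral_ae_eq => // A _ mA.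
  by rewrite -Radon_Nikodym_SigmaFinite.f_integral// nuE.
apply: ge0_ae_eq_integral => //.
- exact: emeasurable_funM.
- exact: emeasurable_funM.
- by move=> t _; rewrite mule_ge0//; exact: Radon_Nikodym_SigmaFinite.f_ge0.
- by move=> t _; rewrite mule_ge0// lee_fin normal_pdf_ge0.
- by apply: filterS e => t /(_ I) -> _.
Qed.

(** Domination by the density of twice the standard deviation: |t| is at most 1 + t^2, which the
    difference of the two exponents absorbs. *)
Lemma normal_pdf_moment_bound (sigma t : R) : 0 < sigma ->
  `|t| * normal_pdf 0 sigma t <=
  (1 + 8 * sigma ^+ 2 / 3) * normal_peak sigma / normal_peak (2 * sigma) *
    normal_pdf 0 (2 * sigma) t.
Proof.
move=> s0; have s20 : 2 * sigma != 0 by rewrite mulf_neq0// gt_eqF.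
have sn0 : sigma != 0 by rewrite gt_eqF.
rewrite !normal_pdfE// /normal_fun subr0.
have pk := normal_peak_gt0 sn0; have pk2 := normal_peak_gt0 s20.
(* [y] is the difference of the exponents t^2/(2 sigma^2) and t^2/(8 sigma^2); hence t^2 = (8
   sigma^2 / 3) y, the source of the constant, and 1 + y is at most [expR y]. *)
pose y := 3 * t ^+ 2 / (8 * sigma ^+ 2).
have -> : - t ^+ 2 / ((2 * sigma) ^+ 2 *+ 2) = - t ^+ 2 / (sigma ^+ 2 *+ 2) + y.
  by rewrite /y -mulr_natr -[in RHS]mulr_natr; field.
rewrite expRD.
have -> : (1 + 8 * sigma ^+ 2 / 3) * normal_peak sigma / normal_peak (2 * sigma) *
    (normal_peak (2 * sigma) * (expR (- t ^+ 2 / (sigma ^+ 2 *+ 2)) * expR y)) =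
    (1 + 8 * sigma ^+ 2 / 3) * expR y *
      (normal_peak sigma * expR (- t ^+ 2 / (sigma ^+ 2 *+ 2))).
  by field; rewrite gt_eqF.
apply: ler_wpM2r; first by rewrite mulr_ge0 ?expR_ge0// ltW.
have y0 : 0 <= y by rewrite /y divr_ge0// mulr_ge0// sqr_ge0.
have t2 : 8 * sigma ^+ 2 / 3 * y = t ^+ 2 by rewrite /y; field.
have c0 : 0 <= 8 * sigma ^+ 2 / 3 by rewrite divr_ge0// mulr_ge0// sqr_ge0.
apply: (@le_trans _ _ ((1 + 8 * sigma ^+ 2 / 3) * (1 + y))); last first.
  by apply: ler_wpM2l; [rewrite addr_ge0|exact: expR_ge1Dx].
apply: (@le_trans _ _ (1 + t ^+ 2)).
  have := sqr_ge0 (`|t| - 1); rewrite -(real_normK (num_real t)).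
  by have := normr_ge0 t; nra.
by rewrite -t2; nra.
Qed.

Lemma normal_first_moment (sigma : R) : 0 < sigma ->
  (\int[leb]_t (`|t|%:E * (normal_pdf 0 sigma t)%:E) < +oo)%E.
Proof.
move=> s0; pose C := (1 + 8 * sigma ^+ 2 / 3) * normal_peak sigma / normal_peak (2 * sigma).
have C0 : 0 <= C.
  rewrite /C !mulr_ge0 ?invr_ge0 ?normal_peak_ge0//.
  by rewrite addr_ge0// divr_ge0// mulr_ge0// sqr_ge0.
have mpdf s : measurable_fun setT (fun t => (normal_pdf 0 s t)%:E).
  by apply/measurable_EFinP; exact: measurable_normal_pdf.
apply: (@le_lt_trans _ _ (\int[leb]_t (C%:E * (normal_pdf 0 (2 * sigma) t)%:E))%E).
  apply: ge0_le_integral => //.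
  - by move=> t _; rewrite mule_ge0// lee_fin// normal_pdf_ge0.
  - apply: emeasurable_funM; last exact: mpdf.
    by apply/measurable_EFinP; exact: normr_measurable.
  - by apply: emeasurable_funM => //; exact: mpdf.
  - by move=> t _; rewrite -!EFinM lee_fin; exact: normal_pdf_moment_bound.
rewrite ge0_integralZl_EFin//.
- by rewrite integral_normal_pdf mule1 ltry.
- by move=> t _; rewrite lee_fin normal_pdf_ge0.
- exact: mpdf.
Qed.

End NormalMoment.

(** Reversal preserves the product of the two noise variances, hence the normalising constant; [q]
    stands for pi. *)
Lemma rotation_peak (F : fieldType) (sx sy v q : F) : v != 0 ->
  (sx * sy) ^+ 2 / v * q *+ 2 * (v * q *+ 2) = sx ^+ 2 * q *+ 2 * (sy ^+ 2 * q *+ 2).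
Proof. by move=> v0; field. Qed.

(* completing the square in the pair of Gaussian factors of the reversed edge *)
Lemma rotation_square (F : realFieldType) (a sx sy U E : F) : 0 < sx -> 0 < sy ->
  let v := a ^+ 2 * sx ^+ 2 + sy ^+ 2 in
  (U - a * sx ^+ 2 / v * (E + a * U)) ^+ 2 / ((sx * sy) ^+ 2 / v) +
    (E + a * U) ^+ 2 / v = U ^+ 2 / sx ^+ 2 + E ^+ 2 / sy ^+ 2.
Proof.
move=> sx0 sy0; have v0 : 0 < a ^+ 2 * sx ^+ 2 + sy ^+ 2.
  by rewrite ltr_wpDl ?exprn_gt0// mulr_ge0 ?sqr_ge0.
by field; rewrite (gt_eqF sx0) (gt_eqF sy0) exprMn (gt_eqF v0).
Qed.

(** * The structural equations of the reversed model *)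

Section Reversal.
Context {R : realType} {p : nat}.
Local Notation V := (p.-tuple R).
Variables (P : probability V R) (D : rel 'I_p) (mu sigma : 'I_p -> R)
  (f : 'I_p -> 'I_p -> R -> R).
Hypotheses (dD : is_dag D) (ws : weak_sem P D mu f sigma).

Definition centred (h : V -> R) := P.-integrable setT (EFin \o h) /\
  (\int[P]_x (h x)%:E = 0)%E.

Lemma centred_lin (g h : V -> R) a : centred g -> centred h -> centred (fun x => g x + a * h x).
Proof.
move=> [ig g0] [ih h0]; have iah : P.-integrable setT (fun x => (a%:E * (h x)%:E)%E).
  exact: integrableZl.
split.
  by apply: (eq_integrable _ _ _ _ (integrableD _ ig iah)) => //.
under eq_integral do rewrite EFinD EFinM.
by rewrite integralD//= integralZl// g0 h0 mule0 adde0.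
Qed.

Lemma edge_centred i j : D i j -> centred (fun x => f j i (tnth x i)).
Proof. by move=> Dij; split; [exact: sem_integrable ws _ _ Dij|exact: sem_mean ws _ _ Dij]. Qed.

Lemma noise_integrable j : P.-integrable setT (fun x => (tnth (noise D mu f x) j)%:E).
Proof.
have mf i k : D i k -> measurable_fun setT (f k i).
  by move=> /(sem_C2 ws); exact: C2_measurable.
have mn := @measurable_noise _ _ D mu f mf.
have mnj : measurable_fun setT (fun x => tnth (noise D mu f x) j : measurableTypeR R).
  exact: (measurableT_comp (measurable_tnth j)).
apply/integrableP; split; first exact/measurable_EFinP.
have [nu nuE] := probability_pushforward P mnj.
have law := (noise_law mu sigma dD mf P).2 (sem_density ws).
have nuN A : measurable A -> nu A = normal_prob 0 (sigma j) A.
  move=> mA; pose B i := if i == j then A else setT.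
  have mB i : measurable (B i) by rewrite /B; case: ifP.
  rewrite nuE -[LHS](_ : P (noise D mu f @^-1` box B) = _).
    rewrite law// (bigD1 j)//= /B eqxx big1 ?mule1// => i /negbTE ->.
    by rewrite probability_setT.
  congr (P _); apply/seteqP; split => x /=; first by move/(_ j); rewrite /B eqxx.
  by move=> h i; rewrite /B; case: eqP => [->|].
have mabs : measurable_fun setT (fun t : R => `|t|%:E).
  by apply/measurable_EFinP; exact: normr_measurable.
have := @ge0_integral_transfer _ _ _ _ _ P nu _ setT (fun t => `|t|%:E) mnj nuE measurableT mabs
  (fun=> normr_ge0 _).
rewrite preimage_setT /= => <-.
by rewrite (@ge0_integral_normal_prob _ (sigma j) nu)//;
  exact: normal_first_moment (sem_sigma ws j).
Qed.

(** The reversed edge function is affine in [X_y], so its centring requires the mean of [X_y]. *)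
Lemma coordinate_integrable j : P.-integrable setT (fun x => (tnth x j)%:E).
Proof.
have im : P.-integrable setT (fun x => (mechanism D mu f j x)%:E).
  apply: (eq_integrable _ _ _ _ (integrableD _ (finite_measure_integrable_cst P (mu j) _)
    (integrable_sum _ (index_enum 'I_p)
      (fun i Dij => sem_integrable ws (j := j) (i := i) Dij)))) => //.
  by move=> x _ /=; rewrite sumEFin.
apply: (eq_integrable _ _ _ _ (integrableD _ im (noise_integrable j))) => // x _ /=.
by rewrite -EFinD tnth_noise residualE addrC subrK.
Qed.

Section Edge.
Variables (x y : 'I_p) (a : R).
Hypotheses (cov : covered D x y) (aff : forall u, f y x u = f y x 0 + u * a).

Let xy : (x == y) = false.
Proof. by case: cov => Dxy _; apply: contraTF Dxy => /eqP ->; rewrite dag_irr. Qed.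

Let yx : (y == x) = false. Proof. by rewrite eq_sym. Qed.

Let D' := reverse_edge D x y.

Let pay i : D i y = D i x || (i == x). Proof. by case: cov => _ ->. Qed.

Let D'y i : D' i y = D i x.
Proof.
rewrite /D' /reverse_edge eqxx andbT yx andbF orbF pay.
by case: (eqVneq i x) => [->|_]; rewrite ?andbF ?dag_irr// orbF andbT.
Qed.

Let D'x i : D' i x = D i x || (i == y).
Proof. by rewrite /D' /reverse_edge eqxx xy andbF andbT andbT. Qed.

Let D'j i j : j != x -> j != y -> D' i j = D i j.
Proof. by rewrite /D' /reverse_edge => /negbTE -> /negbTE ->; rewrite !andbF andbT orbF. Qed.

(* [s2] is the variance of [X_y] given the common parents, [b] the regression
   coefficient of [X_x] on [X_y], and [M] centres the new edge function. *)
Let s2 := a ^+ 2 * sigma x ^+ 2 + sigma y ^+ 2.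
Let b := a * sigma x ^+ 2 / s2.
Let M := fine (\int[P]_z (tnth z y)%:E)%E.
Let muy := mu y + f y x 0 + a * mu x.

(** The equation of [x] is substituted into that of [y], giving the noise eps_y + a eps_x of
    variance [s2]. Subtracting [b] times the result from the equation of [x] leaves the regression
    residual, with the conditional variance of eps_x. The term [b * M] compensates the centring of
    the new edge. *)
Let mu' j := if j == y then muy else if j == x then mu x - b * muy + b * M else mu j.
Let sigma' j := if j == y then Num.sqrt s2
  else if j == x then sigma x * sigma y / Num.sqrt s2 else sigma j.
Let f' j i : R -> R :=
  if j == y then fun u => f y i u + a * f x i u
  else if j == x then
    if i == y then fun u => - (b * M) + b * u
    else fun u => f x i u + - b * (f y i u + a * f x i u)
  else f j i.

Let s0 j : 0 < sigma j. Proof. exact: sem_sigma ws j. Qed.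

Let s2_gt0 : 0 < s2.
Proof. by rewrite ltr_wpDl ?exprn_gt0// mulr_ge0 ?sqr_ge0. Qed.

Let sigma'_gt0 j : 0 < sigma' j.
Proof.
rewrite /sigma'; case: ifP => _; first by rewrite sqrtr_gt0.
by case: ifP => // _; rewrite divr_gt0 ?mulr_gt0 ?sqrtr_gt0.
Qed.

(** Affineness of the edge is used here: the linear term in [z x] cancels against [a] times the
    residual of [x]. *)
Let residual'y z : residual D' mu' f' z y = residual D mu f z y + a * residual D mu f z x.
Proof.
rewrite /residual /mu' eqxx (eq_bigl _ _ D'y).
under eq_bigr do rewrite /f' eqxx.
rewrite big_split -mulr_sumr /= [in RHS](bigD1 x); last by rewrite pay eqxx orbT.
rewrite [X in _ = _ - (_ + X) + _](eq_bigl (fun i => D i x)) => [|i]; last first.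
  rewrite pay; case: (eqVneq i x) => [->|_]; first by rewrite dag_irr.
  by rewrite orbF andbT.
by rewrite aff /muy; ring.
Qed.

Let residual'x z : residual D' mu' f' z x =
  residual D mu f z x - b * (residual D mu f z y + a * residual D mu f z x).
Proof.
rewrite -residual'y /residual /mu' !eqxx xy (eq_bigl _ _ D'y) (bigD1 y) /=; last first.
  by rewrite D'x eqxx orbT.
rewrite [X in _ - (_ + X)](eq_bigl (fun i => D i x)) => [|i]; last first.
  rewrite D'x; case: (eqVneq i y) => [->|_]; last by rewrite orbF andbT.
  by rewrite andbF (dag_asym dD) //; case: cov.
rewrite {1}/f' xy !eqxx.
have -> : \sum_(i | D i x) f' x i (z i) =
    \sum_(i | D i x) f x i (z i) - b * \sum_(i | D i x) f' y i (z i).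
  rewrite mulr_sumr -sumrB; apply: eq_bigr => i Dix; rewrite /f' xy !eqxx.
  case: eqP => [iy|_]; last by ring.
  by case: cov => Dxy _; rewrite iy (dag_asym dD Dxy) in Dix.
by ring.
Qed.

Let residual'j z j : j != x -> j != y -> residual D' mu' f' z j = residual D mu f z j.
Proof.
move=> jx jy; rewrite /residual /mu' /f' (negbTE jx) (negbTE jy).
by congr (_ - _); apply: eq_bigl => i; rewrite D'j.
Qed.

Let density_eq : gauss_density sigma' \o noise D' mu' f' = gauss_density sigma \o noise D mu f.
Proof.
apply/funext => z /=.
rewrite !gauss_densityE//.
have nE D1 mu1 f1 (sigma1 : 'I_p -> R) :
    \sum_j (tnth (noise D1 mu1 f1 z) j / sigma1 j) ^+ 2 =
    \sum_j (residual D1 mu1 f1 (tnth z) j / sigma1 j) ^+ 2.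
  by apply: eq_bigr => j _; rewrite tnth_noise.
rewrite !nE; congr (_ * expR (- _ / 2)).
  rewrite (bigD1 x)//= (bigD1 y) ?yx//= [RHS](bigD1 x)//= [in RHS](bigD1 y) ?yx//=.
  rewrite !mulrA; congr (_ * _); last first.
    by apply: eq_bigr => j /andP[jx jy]; rewrite /sigma' (negbTE jx) (negbTE jy).
  rewrite /normal_peak -!invfM -!sqrtrM; last 2 first.
  - by rewrite mulrn_wge0// mulr_ge0 ?sqr_ge0// pi_ge0.
  - by rewrite mulrn_wge0// mulr_ge0 ?sqr_ge0// pi_ge0.
  congr (_ ^-1); congr Num.sqrt; rewrite /sigma' xy !eqxx.
  rewrite sqr_sqrtr ?ltW// expr_div_n sqr_sqrtr ?ltW//.
  by apply: rotation_peak; rewrite gt_eqF.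
rewrite (bigD1 x)//= (bigD1 y) ?yx//= [RHS](bigD1 x)//= [in RHS](bigD1 y) ?yx//=.
rewrite !addrA; congr (_ + _); last first.
  apply: eq_bigr => j /andP[jx jy].
  by rewrite residual'j// /sigma' (negbTE jx) (negbTE jy).
rewrite residual'y residual'x /sigma' xy !eqxx !expr_div_n sqr_sqrtr ?ltW// /b.
set U := residual _ _ _ _ x; set E := residual _ _ _ _ y.
exact: rotation_square.
Qed.

Lemma weak_sem_reverse : exists mu f sigma, weak_sem P D' mu f sigma.
Proof.
have c2 i j : D i j -> C2 (f j i) by move=> Dij; exact: (sem_C2 ws Dij).
have cen i j : D' i j -> centred (fun z => f' j i (tnth z i)).
  rewrite /f'; case: (eqVneq j y) => [->|jy].
    rewrite D'y => Dix; apply: centred_lin; apply: edge_centred => //.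
    by rewrite pay Dix.
  case: (eqVneq j x) => [->|jx]; last first.
    by rewrite D'j//; exact: edge_centred.
  rewrite D'x; case: (eqVneq i y) => [-> _|_].
    have iy := coordinate_integrable y.
    have ic : P.-integrable setT (EFin \o cst (- (b * M))).
      exact: finite_measure_integrable_cst.
    have ib : P.-integrable setT (fun z => (b%:E * (tnth z y)%:E)%E) by exact: integrableZl.
    split.
      by apply: (eq_integrable _ _ _ _ (integrableD _ ic ib)).
    under eq_integral do rewrite EFinD EFinM.
    rewrite integralD//= integralZl// integral_cst//.
    rewrite [X in (_ * X + _)%E](_ : _ = 1%E) ?mule1; last exact: probability_setT.
    by rewrite -[X in (_ * X)%E]fineK ?integrable_fin_num// -/M -EFinM -EFinD addNr.
  rewrite orbF => Dix.
  have cy : centred (fun z => f y i (tnth z i)) by apply: edge_centred; rewrite pay Dix.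
  exact: (centred_lin (- b) (edge_centred Dix) (centred_lin a cy (edge_centred Dix))).
exists mu', f', sigma'; split => //.
- move=> i j; rewrite /f'; case: (eqVneq j y) => [->|jy].
    by rewrite D'y => Dix; apply: C2_lin; apply: c2 => //; rewrite pay Dix.
  case: (eqVneq j x) => [->|jx]; last by rewrite D'j//; exact: c2.
  rewrite D'x; case: (eqVneq i y) => [-> _|_].
    by apply: C2_lin; [exact: C2_cst|exact: C2_id].
  rewrite orbF => Dix; apply: C2_lin; first exact: c2.
  by apply: C2_lin; apply: c2 => //; rewrite pay Dix.
- by move=> i j /cen[].
- by move=> i j /cen[].
- by rewrite density_eq; exact: sem_density ws.
Qed.

End Edge.

End Reversal.

(** * The equivalence class *)
Section EquivalenceClass.
Context {R : realType} {p : nat}.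
Variable P : probability (p.-tuple R) R.
Local Notation S := (distr_equiv_class P).
Local Notation G := (pdag_of_class S).
Implicit Types D : rel 'I_p.

Lemma class_dsep_le D1 D2 : S D1 -> S D2 -> dsep_le D1 D2.
Proof.
by move=> [_ f1 _] [_ f2 _] A B C dAB dAC dBC /(f1 _ _ _ dAB dAC dBC)/(f2 _ _ _ dAB dAC dBC).
Qed.

Lemma class_skel D1 D2 i j : S D1 -> S D2 -> skel D1 i j -> skel D2 i j.
Proof.
move=> S1 S2; have [d1 _ _] := S1; have [d2 _ _] := S2.
exact: dsep_le_skel d2 d1 (class_dsep_le S2 S1).
Qed.

Lemma class_vstruct D1 D2 i k j : S D1 -> S D2 ->
  dag_vstruct D1 i k j -> dag_vstruct D2 i k j.
Proof.
move=> S1 S2; have [d1 _ _] := S1; have [d2 _ _] := S2.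
exact: dsep_le_vstruct d1 d2 (class_dsep_le S1 S2) (class_dsep_le S2 S1).
Qed.

Lemma class_pdag_adj D i j : S D -> skel D i j <-> pdag_adj G i j.
Proof.
move=> SD; have adjE u v : (exists D', S D' /\ skel D' u v) -> skel D u v.
  by move=> [D' [S' s']]; exact: class_skel S' SD s'.
split=> [s|].
  have a1 : exists D', S D' /\ skel D' i j by exists D.
  have a2 : exists D', S D' /\ skel D' j i by exists D; rewrite skelC.
  have [d1|nd1] := pselect (pdir G i j); first by left.
  have [d2|nd2] := pselect (pdir G j i); first by right; left.
  by right; right; left; split.
case=> [[/adjE //]|[[/adjE]|[[/adjE //]|[/adjE]]]]; by rewrite skelC.
Qed.

Lemma class_pdag_vstruct D i k j : S D -> dag_vstruct D i k j -> pdag_vstruct G i k j.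
Proof.
move=> SD v; have [ik jk ij nadj] := v; split => //.
- split; first by exists D; rewrite /skel ik.
  by move=> D' S'; have [] := class_vstruct SD S' v.
- split; first by exists D; rewrite /skel jk.
  by move=> D' S'; have [] := class_vstruct SD S' v.
- by move=> /(class_pdag_adj i j SD).2; apply/negP.
Qed.

Lemma class_reverse_edge D1 D2 x y : S D1 -> S D2 -> covered D1 x y -> D2 y x ->
  S (reverse_edge D1 x y).
Proof.
move=> [d1 fa1 g1] [d2 _ g2] cov D2yx.
have [mu1 [f1 [s1 ws1]]] := generated_weak_sem d1 g1.
have [mu2 [f2 [s2 ws2]]] := generated_weak_sem d2 g2.
have [k ek] := weak_sem_potential ws1 ws2.
have aff := covered_edge_affine d1 d2 (sem_sigma ws1) (sem_sigma ws2)
  (fun i j Dij u => C2_derivable (x := u) (sem_C2 ws1 Dij)) ek cov D2yx.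
have [mu [f [s ws]]] := weak_sem_reverse d1 ws1 cov aff.
have d' := reverse_edge_dag d1 cov.
have fa' : faithful P (reverse_edge D1 x y).
  move=> A B C dAB dAC dBC; rewrite (fa1 A B C dAB dAC dBC).
  exact: reverse_edge_dsep.
split => //; apply: (weak_sem_generated d' ws) => i j.
exact: (faithful_edge_nonzero d' ws fa').
Qed.

Lemma consistent_extension_class D0 D : S D0 -> consistent_extension G D -> S D.
Proof.
move=> S0 [dD skD dirD vD].
have skE D1 : S D1 -> skel D1 =2 skel D.
  move=> S1 i j; apply/idP/idP => [/(class_pdag_adj i j S1)|]; first by move/skD.
  by move/skD/(class_pdag_adj i j S1).
have vE D1 i k j : S D1 -> dag_vstruct D i k j -> dag_vstruct D1 i k j.
  move=> S1 /vD [[_ ik] [_ jk] ij nadj]; split => //; [exact: ik|exact: jk|].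
  by apply/negP => /(class_pdag_adj i j S1).
have vE' D1 i k j : S D1 -> dag_vstruct D1 i k j -> dag_vstruct D i k j.
  move=> S1 /(class_pdag_vstruct S1) [ik jk ij nadj].
  by split => //; [exact: dirD|exact: dirD|apply/negP => /skD].
(* Decreasing measure: the edges on which the member and [D] disagree. Reversing [x -> y] removes
   one of them and creates none; with equal skeletons, no disagreement means equality. *)
pose dis D1 := [set e : 'I_p * 'I_p | D1 e.1 e.2 && D e.2 e.1]%SET.
have [n] := ubnP #|dis D0|; elim: n D0 S0 => // n IH D1 S1; rewrite ltnS => disn.
have [d1 _ _] := S1.
have [[u v] /= | none] := pickP [pred e : 'I_p * 'I_p | D1 e.1 e.2 && D e.2 e.1].
  move=> /andP[uv vu].
  have [x [y [cov Dyx]]] := exists_covered_disagreement d1 dD (skE _ S1)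
    (fun i k j => vE' D1 i k j S1) (fun i k j => vE D1 i k j S1) uv vu.
  have [D1xy _] := cov.
  have [D2 [S2 D2yx]] : exists D2, S D2 /\ D2 y x.
    have [d|nd] := pselect (pdir G x y).
      by have := dag_asym dD (dirD _ _ d); rewrite Dyx.
    have [D2 [S2 nxy]] : exists D2, S D2 /\ ~ D2 x y.
      apply: contra_notP nd => /forallNP H; split; first by exists D1; rewrite /skel D1xy.
      by move=> D2 S2; apply: contrapT => nxy; apply: (H D2).
    exists D2; split => //; have : skel D2 x y by apply: class_skel S1 S2 _; rewrite /skel D1xy.
    by case/orP.
  apply: (IH _ (class_reverse_edge S1 S2 cov D2yx)).
  apply: leq_trans disn; apply: proper_card; apply/properP; split.
    apply/fintype.subsetP => -[a b]; rewrite !inE /= /reverse_edge.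
    case/andP => /orP[/andP[-> _] -> //|/andP[/eqP -> /eqP ->]].
    by rewrite (dag_asym dD Dyx).
  exists (x, y); rewrite !inE /= ?D1xy ?Dyx// andbT /reverse_edge !eqxx andbF /=.
  by apply/negP => /andP[/eqP xy _]; rewrite xy dag_irr in D1xy.
suff <- : D1 = D by [].
apply/funext => u; apply/funext => v; have := none (u, v); have := none (v, u).
have := skE D1 S1 u v; rewrite /skel /=.
have := dag_asym d1 (u := u) (v := v); have := dag_asym dD (u := u) (v := v).
by case: (D1 u v); case: (D u v); case: (D1 v u); case: (D v u) => h1 h2 h3 h4 h5 //;
  have := h1 isT; have := h2 isT.
Qed.

End EquivalenceClass.

Theorem mainTheorem1 (R : realType) (p : nat) (P : probability (p.-tuple R) R)
    (D0 : rel 'I_p) :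
  is_dag D0 -> generated_by_PLSEM P D0 -> faithful P D0 ->
  forall D : rel 'I_p,
    distr_equiv_class P D <->
    consistent_extension (pdag_of_class (distr_equiv_class P)) D.
Proof.
move=> d0 g0 f0 D; have S0 : distr_equiv_class P D0 by [].
split=> [SD|]; last exact: (consistent_extension_class S0).
split; first by case: SD.
- by move=> i j; exact: class_pdag_adj.
- by move=> i j [_]; apply.
- by move=> i k j; exact: class_pdag_vstruct.
Qed.
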